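(* Let $\mathfrak F\subset\mathbb S_{++}^d$ be nonempty, closed, and geodesically convex for the affine-invariant metric. Let $H_1,\dots,H_q\in\mathbb S_{++}^d$, let $\phi_1,\dots,\phi_q:\mathbb R^d\to\mathbb R$ be convex and permutation invariant, and set $$\Omega_a(G)=\phi_a\bigl(\log\lambda(G^{-1/2}H_aG^{-1/2})\bigr).$$ If $\rho:\mathbb R^q\to\mathbb R$ is convex and nondecreasing in every coordinate, then $$\mathcal J(G)=\rho(\Omega_1(G),\ldots,\Omega_q(G))$$ is closed and geodesically convex on $\mathfrak F$. The same conclusion holds for each fixed $t$ when $H_{t,a},\phi_{t,a},\rho_t$ (satisfying these hypotheses for each $t$) vary continuously in time $t$. If every $\phi_a$ satisfies $\phi_a(x+s\mathbf 1)=\phi_a(x)$ for all $x\in\mathbb R^d$, $s\in\mathbb R$, then $\mathcal J(cG)=\mathcal J(G)$ for all $c>0$, where $\mathcal J$ is evaluated by its defining formula. If each $\phi_a$ is $L_a$-Lipschitz and $\rho$ is $L_\rho$-Lipschitz (with respect to Euclidean norms), and $\widehat{\mathcal J}$ denotes the objective obtained by replacing each $H_a$ by $\widehat H_a\in\mathbb S_{++}^d$, then $$\sup_{G\in\mathfrak F}|\widehat{\mathcal J}(G)-\mathcal J(G)|\le L_\rho\Bigl(\sum_{a=1}^qL_a^2\,d_{\mathrm{AI}}(H_a,\widehat H_a)^2\Bigr)^{1/2}.$$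
   Context: $\mathbb S_{++}^d$ denotes real symmetric positive-definite $d\times d$ matrices with the affine-invariant Riemannian metric $\|Z\|_{S,\mathrm{AI}}=\|S^{-1/2}ZS^{-1/2}\|_F$ and distance $d_{\mathrm{AI}}(S_0,S_1)=\|\log(S_0^{-1/2}S_1S_0^{-1/2})\|_F$. The unique geodesic from $G_0$ to $G_1$ is $G_0\#_tG_1=G_0^{1/2}(G_0^{-1/2}G_1G_0^{-1/2})^tG_0^{1/2}$, $t\in[0,1]$; sets and functions are geodesically convex with respect to these geodesics. A function is closed if it is lower semicontinuous. $\lambda(X)\in\mathbb R^d$ is the vector of eigenvalues of a symmetric matrix (in any order) and $\log$ acts entrywise on it; $\mathbf 1$ is the all-ones vector. *)

(* Defs.v *)
From HB Require Import structures.
From mathcomp Require Import all_boot all_order all_algebra all_fingroup.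
From mathcomp Require Import all_classical all_reals all_analysis.

Set Implicit Arguments.
Unset Strict Implicit.
Unset Printing Implicit Defensive.

Import Order.TTheory GRing.Theory Num.Theory.
Import numFieldNormedType.Exports.

Local Open Scope classical_set_scope.
Local Open Scope ring_scope.

Section Definitions.
Variable R : realType.

(* The norm that MathComp-Analysis puts on matrices is the max norm, hence this
   definition; on row vectors it is the Euclidean norm. *)
Definition frob m n (A : 'M[R]_(m, n)) : R :=
  Num.sqrt (\sum_i \sum_j A i j ^+ 2).

Definition euclid_lipschitz n (L : R) (f : 'rV[R]_n -> R) : Prop :=
  forall x y, `|f x - f y| <= L * frob (x - y).

Definition perm_invariant n (f : 'rV[R]_n -> R) : Prop :=
  forall (s : 'S_n) (x : 'rV[R]_n), f (col_perm s x) = f x.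

Definition coord_nondecreasing n (f : 'rV[R]_n -> R) : Prop :=
  forall (i : 'I_n) (x y : 'rV[R]_n),
    (forall j, j != i -> x 0 j = y 0 j) -> x 0 i <= y 0 i -> f x <= f y.

Section Matrices.
Variable d : nat.
Implicit Types A S G H : 'M[R]_d.

Definition spd : set 'M[R]_d :=
  [set S | S^T = S /\ forall u : 'rV[R]_d, u != 0 -> 0 < (u *m S *m u^T) 0 0].

(* Eigenvalues with multiplicity, in an unspecified order; the value is junk
   if the characteristic polynomial does not split over R, which does not
   happen for symmetric matrices. *)
Definition eigvals A : 'rV[R]_d :=
  xget 0 [set l : 'rV[R]_d | char_poly A = \prod_(i < d) ('X - (l 0 i)%:P)].

(* Spectral functional calculus on symmetric matrices: if
   A = U diag(l) U^T with U orthogonal, then f(A) = U diag(f(l)) U^T, which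
   does not depend on the diagonalization (U, l). *)
Definition mxfun (f : R -> R) A : 'M[R]_d :=
  xget 0 [set B | exists (U : 'M[R]_d) (l : 'rV[R]_d),
    [/\ U *m U^T = 1%:M, A = U *m diag_mx l *m U^T
      & B = U *m diag_mx (map_mx f l) *m U^T]].

Definition mxpow A (t : R) : 'M[R]_d := mxfun (fun x => x `^ t) A.
Definition mxlog A : 'M[R]_d := mxfun (@ln R) A.
Definition mxsqrt A : 'M[R]_d := mxpow A 2^-1.
Definition mxisqrt A : 'M[R]_d := mxpow A (- 2^-1).

Definition ai_dist S0 S1 : R :=
  frob (mxlog (mxisqrt S0 *m S1 *m mxisqrt S0)).

Definition ai_geodesic G0 G1 (t : R) : 'M[R]_d :=
  mxsqrt G0 *m mxpow (mxisqrt G0 *m G1 *m mxisqrt G0) t *m mxsqrt G0.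

(* F is closed in the metric space (spd, ai_dist), not in 'M[R]_d; for instance
   spd itself qualifies. *)
Definition ai_closed_set (F : set 'M[R]_d) : Prop :=
  forall G, spd G ->
    (forall e, 0 < e -> exists2 G', F G' & ai_dist G G' < e) -> F G.

Definition geod_convex_set (F : set 'M[R]_d) : Prop :=
  forall G0 G1 t, F G0 -> F G1 -> 0 <= t -> t <= 1 ->
    F (ai_geodesic G0 G1 t).

(* Lower semicontinuity of the restriction of J to the metric space
   (F, ai_dist). *)
Definition ai_closed_on (F : set 'M[R]_d) (J : 'M[R]_d -> R) : Prop :=
  forall G a, F G -> a < J G ->
    exists2 r, 0 < r & forall G', F G' -> ai_dist G G' < r -> a < J G'.

Definition geod_convex_on (F : set 'M[R]_d) (J : 'M[R]_d -> R) : Prop :=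
  forall G0 G1 t, F G0 -> F G1 -> 0 <= t -> t <= 1 ->
    J (ai_geodesic G0 G1 t) <= (1 - t) * J G0 + t * J G1.

Definition Omega (phi : 'rV[R]_d -> R) H G : R :=
  phi (map_mx (@ln R) (eigvals (mxisqrt G *m H *m mxisqrt G))).

Variable q : nat.

Definition objective (H : 'I_q -> 'M[R]_d) (phi : 'I_q -> 'rV[R]_d -> R)
    (rho : 'rV[R]_q -> R) G : R :=
  rho (\row_(a < q) Omega (phi a) (H a) G).

Definition admissible (H : 'I_q -> 'M[R]_d) (phi : 'I_q -> 'rV[R]_d -> R)
    (rho : 'rV[R]_q -> R) : Prop :=
  [/\ forall a, spd (H a),
      forall a, convex_function setT (phi a),
      forall a, perm_invariant (phi a),
      convex_function setT rho
    & coord_nondecreasing rho].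

End Matrices.
End Definitions.

(* Main.v *)
Require Import Defs.
From HB Require Import structures.
From mathcomp Require Import all_boot all_order all_algebra all_fingroup.
From mathcomp Require Import all_classical all_reals all_analysis.
From mathcomp Require Import ring lra.
From mathcomp.real_closed Require Import complex.

(** The statement reduces to two facts about the sorted log-spectra of positive
    definite matrices, and both come from one inequality.

    The inequality is the multiplicative Lidskii theorem
    ([multiplicative_lidskii]): if [X = S Z S^T] and [Y = S S^T] have sorted
    log-spectra [x] and [y], and [Z] has log-spectrum [z], then [x - y] is
    majorized by [z].  Its proof truncates [z] from below at a threshold and uses
    only Weyl monotonicity of eigenvalues and multiplicativity of determinants.
    The passage from majorization to convex permutation-invariant functions is
    the Hardy-Littlewood-Polya theorem ([convex_symmetric_majorization]).

    First fact ([log_spectrum_dist]): applied to the squared norm, Lidskii gives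
    [|x - y| <= |z|].  When [Z = H^(-1/2) H' H^(-1/2)], the right side is the
    affine-invariant distance of [H] and [H'].  This yields the perturbation
    bound, since whitening by [G] is a congruence.  With the roles of [G] and [H]
    exchanged it shows that the log-spectrum is 1-Lipschitz in [G] for the
    affine-invariant distance; as finite convex functions on [R^n] are continuous
    ([convex_continuous]), the objective is even continuous.

    Second fact ([spd_curve_convex]): [phi] of the log-spectrum is convex along
    geodesics.  The spectrum of [G^(-1/2) H G^(-1/2)] is that of
    [H^(1/2) G^-1 H^(1/2)], which runs along a curve [N(t) = C exp(t E) C^T] when
    [G] runs along a geodesic.  On this curve [N(t) = N(m) N(s)^-1 N(m)] for the
    midpoint [m] of [s] and [t], so Lidskii with [S = N(m)] shows that the sums
    of the [k] largest log-eigenvalues are midpoint convex.  They are bounded on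
    [0, 1], hence convex, and the total is affine; this is the majorization that
    [phi] requires.  A convex coordinatewise nondecreasing [rho] preserves
    convexity.

    Scaling [G] by [c] translates every log-spectrum by [- ln c], which gives the
    invariance statement.  For time-dependent data each instant is an instance of
    the static result. *)

Set Implicit Arguments.
Unset Strict Implicit.
Unset Printing Implicit Defensive.

Import Order.TTheory GRing.Theory Num.Theory.
Import numFieldNormedType.Exports.

Local Open Scope classical_set_scope.
Local Open Scope ring_scope.

(** * Diagonalization of real symmetric matrices *)
Section Spectral.
Variable R : realType.

Lemma sum_sqr_row n (u : 'rV[R]_n) : (u *m u^T) 0 0 = \sum_i u 0 i ^+ 2.
Proof. by rewrite mxE; apply: eq_bigr => i _; rewrite mxE expr2. Qed.

Lemma sqnorm_ge0 n (u : 'rV[R]_n) : 0 <= (u *m u^T) 0 0.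
Proof. by rewrite sum_sqr_row; apply: sumr_ge0 => i _; exact: sqr_ge0. Qed.

Lemma sqnorm_eq0 n (u : 'rV[R]_n) : ((u *m u^T) 0 0 == 0) = (u == 0).
Proof.
apply/idP/eqP => [|->]; last by rewrite mul0mx mxE.
rewrite sum_sqr_row psumr_eq0 => [/allP u0|i _]; last exact: sqr_ge0.
by apply/rowP => i; move/(_ i (mem_index_enum i)): u0; rewrite mxE sqrf_eq0 => /eqP.
Qed.

Lemma sqnorm_gt0 n (u : 'rV[R]_n) : u != 0 -> 0 < (u *m u^T) 0 0.
Proof. by move=> u0; rewrite lt_def sqnorm_eq0 u0 sqnorm_ge0. Qed.

(** An eigenvalue [a + ib] exists over [R[i]].  If [x + iy] is an eigenvector
    for it, symmetry gives [(x A) y^T = (y A) x^T], that is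
    [b (|x|^2 + |y|^2) = 0]; so [b = 0], and [x] or [y] is a nonzero real
    eigenvector. *)
Lemma symmetric_eigenvector n (A : 'M[R]_n.+1) : A^T = A ->
  exists a, exists2 v : 'rV_n.+1, v != 0 & v *m A = a *: v.
Proof.
move=> symA.
have [z] := @eigenvalue_closed R[i] _ (map_mx (real_complex R) A) (ltn0Sn n).
case: z => a b /eigenvalueP[v vA v0].
pose x := map_mx (@complex.Re R) v; pose y := map_mx (@complex.Im R) v.
have ReM (s : R[i]) (t : R) : complex.Re (s * t%:C%C) = complex.Re s * t.
  by case: s => p q /=; rewrite mulr0 subr0.
have ImM (s : R[i]) (t : R) : complex.Im (s * t%:C%C) = complex.Im s * t.
  by case: s => p q /=; rewrite mulr0 add0r.
have xA : x *m A = a *: x - b *: y.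
  apply/rowP => i; move/rowP/(_ i)/(congr1 (@complex.Re R)): vA.
  rewrite !mxE raddf_sum /=; under eq_bigr do rewrite !mxE ReM.
  by under [in X in _ -> X]eq_bigr do rewrite mxE; move=> ->; case: (v 0 i).
have yA : y *m A = a *: y + b *: x.
  apply/rowP => i; move/rowP/(_ i)/(congr1 (@complex.Im R)): vA.
  rewrite !mxE raddf_sum /=; under eq_bigr do rewrite !mxE ImM.
  by under [in X in _ -> X]eq_bigr do rewrite mxE; move=> ->; case: (v 0 i).
have xy0 : (x != 0) || (y != 0).
  rewrite -negb_and; apply: contra v0 => /andP[/eqP x0 /eqP y0].
  apply/eqP/rowP => i; move/rowP/(_ i): x0; move/rowP/(_ i): y0.
  by rewrite !mxE; case: (v 0 i) => p q /= -> ->.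
have xAy : (x *m A *m y^T) 0 0 = (y *m A *m x^T) 0 0.
  have -> : y *m A *m x^T = (x *m A *m y^T)^T.
    by rewrite !trmx_mul trmxK symA mulmxA.
  by rewrite [RHS]mxE.
have yx : (y *m x^T) 0 0 = (x *m y^T) 0 0.
  have -> : y *m x^T = (x *m y^T)^T by rewrite trmx_mul trmxK.
  by rewrite mxE.
have /eqP : b * ((x *m x^T) 0 0 + (y *m y^T) 0 0) = 0.
  have entryZB (p q : R) (P Q : 'M[R]_1) :
      (p *: P - q *: Q) 0 0 = p * P 0 0 - q * Q 0 0 by rewrite !mxE.
  have entryZD (p q : R) (P Q : 'M[R]_1) :
      (p *: P + q *: Q) 0 0 = p * P 0 0 + q * Q 0 0 by rewrite !mxE.
  move: xAy; rewrite xA yA mulmxBl mulmxDl -!scalemxAl entryZB entryZD yx.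
  by move=> ?; lra.
have sq_gt0 : 0 < (x *m x^T) 0 0 + (y *m y^T) 0 0.
  by case/orP: xy0 => ?; [apply: ltr_pwDl | apply: ltr_wpDl];
    rewrite ?sqnorm_gt0 ?sqnorm_ge0.
rewrite mulf_eq0 (gt_eqF sq_gt0) orbF => /eqP b0.
exists a; case/orP: xy0 => ?; [exists x | exists y] => //.
  by rewrite xA b0 scale0r subr0.
by rewrite yA b0 scale0r addr0.
Qed.

(** The Householder reflection along [v - e_0] exchanges the unit vectors
    [e_0] and [v]. *)
Lemma orthonormal_completion n (v : 'rV[R]_n.+1) : v *m v^T = 1%:M ->
  exists2 Q : 'M[R]_n.+1, Q *m Q^T = 1%:M & row 0 Q = v.
Proof.
move=> v1.
pose e : 'rV[R]_n.+1 := delta_mx 0 0; pose w := v - e.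
have [w0|w0] := eqVneq w 0.
  exists 1%:M; first by rewrite trmx1 mulmx1.
  by apply/eqP; rewrite row1 eq_sym -subr_eq0 -/e -/w w0.
pose c := (w *m w^T) 0 0.
have c0 : c != 0 by rewrite sqnorm_eq0.
have wwE : w *m w^T = c%:M by rewrite [LHS]mx11_scalar.
have ee : e *m e^T = 1%:M.
  by rewrite trmx_delta mul_delta_mx; apply/matrixP=> i j; rewrite !ord1 !mxE.
have ve : v *m e^T = (v 0 0)%:M.
  rewrite [LHS]mx11_scalar trmx_delta mxE (bigD1 ord0) //= big1 ?addr0 => [|i i0].
    by rewrite !mxE mulr1.
  by rewrite !mxE (negPf i0) mulr0.
have ev : e *m v^T = (v 0 0)%:M.
  by apply: trmx_inj; rewrite trmx_mul trmxK ve tr_scalar_mx.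
have cE : c = 2 * (1 - v 0 0).
  rewrite /c /w linearB /= mulmxBl !mulmxBr v1 ve ev ee !mxE /= !mulr1n; ring.
have ewE : e *m w^T = (- (c / 2))%:M.
  rewrite linearB /= mulmxBr ev ee -raddfB; congr (_%:M).
  by rewrite cE; field.
pose Q := 1%:M - (2 / c) *: (w^T *m w).
have QT : Q^T = Q.
  by rewrite /Q linearB /= trmx1 linearZ /= trmx_mul trmxK.
exists Q.
  have KK : w^T *m w *m (w^T *m w) = c *: (w^T *m w).
    by rewrite mulmxA -(mulmxA _ w) wwE mul_mx_scalar -scalemxAl.
  rewrite QT {1}/Q mulmxBl mul1mx -scalemxAl mulmxBr mulmx1 -scalemxAr KK.
  rewrite /Q scalerBr !scalerA -addrA -opprD -scalerBl -scalerDl.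
  by rewrite (_ : _ + _ = 0 :> R) ?scale0r ?subr0//; field.
rewrite rowE /Q mulmxBr mulmx1 -scalemxAr mulmxA -/e ewE mul_scalar_mx scalerA.
rewrite mulrN (_ : _ / _ * _ = 1 :> R); last by field.
by rewrite scaleN1r opprK /w addrC subrK.
Qed.

(** Deflation: in an orthonormal basis whose first vector is an eigenvector,
    the matrix splits into a 1 x 1 block and a smaller symmetric block. *)
Theorem real_spectral n (A : 'M[R]_n) : A^T = A ->
  exists U : 'M[R]_n, exists l : 'rV[R]_n,
    U *m U^T = 1%:M /\ A = U *m diag_mx l *m U^T.
Proof.
elim: n A => [|n IHn] A symA.
  by exists 1%:M, 0; split; apply/matrixP => - [].
have [a [v v0 vA]] := symmetric_eigenvector symA.
pose c := (Num.sqrt ((v *m v^T) 0 0))^-1.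
have nv : (c *: v) *m (c *: v)^T = 1%:M.
  rewrite linearZ /= -scalemxAl -scalemxAr scalerA [v *m v^T]mx11_scalar.
  rewrite scale_scalar_mx -expr2 exprVn sqr_sqrtr ?sqnorm_ge0//.
  by rewrite mulVf ?sqnorm_eq0.
have [Q QQ rQ] := orthonormal_completion nv.
have QtQ : Q^T *m Q = 1%:M by apply: mulmx1C.
pose B : 'M[R]_(1 + n) := Q *m A *m Q^T.
have symB : B^T = B by rewrite /B !trmx_mul trmxK symA mulmxA.
have rB : row 0 B = a *: delta_mx 0 0.
  rewrite /B !row_mul rQ -scalemxAl vA scalerA mulrC -scalerA -rQ.
  by rewrite -scalemxAl -row_mul QQ row1.
have urB : ursubmx B = 0.
  apply/matrixP => i j; rewrite !mxE !ord1; move/rowP/(_ (rshift 1 j)): rB.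
  rewrite !mxE (_ : lshift n 0 = 0); last exact/val_inj.
  by move=> ->; rewrite mulr0.
have ulB : ulsubmx B = a%:M.
  apply/matrixP => i j; rewrite !ord1 !mxE; move/rowP/(_ 0): rB.
  rewrite !mxE (_ : lshift n 0 = 0); last exact/val_inj.
  by move=> ->; rewrite !eqxx mulr1 mulr1n.
have dlB : dlsubmx B = 0.
  by rewrite -symB -trmx_ursub urB trmx0.
have [V [l [VV drB]]] : exists V : 'M[R]_n, exists l : 'rV[R]_n,
    V *m V^T = 1%:M /\ drsubmx B = V *m diag_mx l *m V^T.
  by apply: IHn; rewrite trmx_drsub symB.
pose W : 'M[R]_(1 + n) := block_mx 1%:M 0 0 V.
have WW : W *m W^T = 1%:M.
  rewrite tr_block_mx !trmx0 trmx1 mulmx_block !(mulmx0, mul0mx, addr0, add0r).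
  by rewrite mulmx1 VV -scalar_mx_block.
have BE : B = W *m diag_mx (row_mx a%:M l) *m W^T.
  rewrite -[LHS]submxK urB ulB dlB drB diag_mx_row tr_block_mx !trmx0 trmx1.
  rewrite !mulmx_block !(mulmx0, mul0mx, addr0, add0r, mulmx1, mul1mx).
  congr (block_mx _ _ _ _); apply/matrixP => i j.
  by rewrite !ord1 !mxE eqxx mulr1n.
exists (Q^T *m W), (row_mx a%:M l); split.
  by rewrite trmx_mul trmxK mulmxA -(mulmxA _ W) WW mulmx1.
rewrite trmx_mul trmxK -!mulmxA (mulmxA W) (mulmxA (W *m _)) -BE /B.
by rewrite -!mulmxA QtQ mulmx1 mulmxA QtQ mul1mx.
Qed.

End Spectral.

(** * Functional calculus and logarithmic spectra *)
Section ExpCalculus.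
Variables (R : realType) (d : nat).
Implicit Types (A S G H U V : 'M[R]_d) (x y l : 'rV[R]_d).

(** For orthogonal [U] this is the exponential of the symmetric matrix
    [U diag(x) U^T].  Every positive definite matrix has this form, and its
    powers, logarithm and inverse are then read off from the exponent [x]. *)
Definition expmx U x : 'M[R]_d := U *m diag_mx (map_mx expR x) *m U^T.

Lemma expmxD U x y : U *m U^T = 1%:M ->
  expmx U x *m expmx U y = expmx U (x + y).
Proof.
move=> /mulmx1C UU; rewrite /expmx !mulmxA -(mulmxA _ U^T) UU mulmx1.
rewrite -(mulmxA U) mulmx_diag; congr (_ *m diag_mx _ *m _).
by apply/rowP => i; rewrite !mxE expRD.
Qed.

Lemma expmx0 U : U *m U^T = 1%:M -> expmx U 0 = 1%:M.
Proof.
move=> UU; rewrite /expmx (_ : map_mx _ _ = const_mx 1).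
  by rewrite diag_const_mx mulmx1.
by apply/rowP => i; rewrite !mxE expR0.
Qed.

Lemma expmxVr U x : U *m U^T = 1%:M -> expmx U x *m expmx U (- x) = 1%:M.
Proof. by move=> UU; rewrite expmxD// subrr expmx0. Qed.

Lemma expmxVl U x : U *m U^T = 1%:M -> expmx U (- x) *m expmx U x = 1%:M.
Proof. by move=> UU; rewrite expmxD// addNr expmx0. Qed.

Lemma tr_expmx U x : (expmx U x)^T = expmx U x.
Proof. by rewrite /expmx !trmx_mul trmxK tr_diag_mx mulmxA. Qed.

Lemma det_expmx U x : U *m U^T = 1%:M -> \det (expmx U x) = expR (\sum_i x 0 i).
Proof.
move=> UU; rewrite /expmx !det_mulmx mulrAC -det_mulmx UU det1 mul1r det_diag.
by rewrite expR_sum; apply: eq_bigr => i _; rewrite mxE.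
Qed.

Lemma diag_quad U l (u : 'rV[R]_d) :
  (u *m (U *m diag_mx l *m U^T) *m u^T) 0 0
  = \sum_i l 0 i * (u *m U) 0 i ^+ 2.
Proof.
rewrite !mulmxA -(mulmxA _ U^T) -trmx_mul mxE; apply: eq_bigr => i _.
by rewrite mul_mx_diag !mxE; ring.
Qed.

Lemma orthogonal_sqnorm U (u : 'rV[R]_d) : U *m U^T = 1%:M ->
  (u *m u^T) 0 0 = \sum_i (u *m U) 0 i ^+ 2.
Proof.
by move=> UU; rewrite -sum_sqr_row trmx_mul mulmxA -(mulmxA u) UU mulmx1.
Qed.

Lemma expmx_spd U x : U *m U^T = 1%:M -> spd (expmx U x).
Proof.
move=> UU; split=> [|u u0]; first exact: tr_expmx.
rewrite diag_quad; have := sqnorm_gt0 u0; rewrite (orthogonal_sqnorm _ UU).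
rewrite lt_def => /andP[u2 _]; rewrite lt_def; apply/andP; split; last first.
  by apply: sumr_ge0 => i _; rewrite mulr_ge0 ?sqr_ge0// mxE expR_ge0.
apply: contra u2; rewrite !psumr_eq0 => [/allP uU|i _|i _]; last 2 first.
- exact: sqr_ge0.
- by rewrite mulr_ge0 ?sqr_ge0// mxE expR_ge0.
apply/allP => i /uU; rewrite mxE mulf_eq0 => /orP[|//].
by rewrite gt_eqF ?expR_gt0.
Qed.

Lemma spd_expmx A : spd A -> exists U x, U *m U^T = 1%:M /\ A = expmx U x.
Proof.
move=> [symA posA]; have [U [l [UU AE]]] := real_spectral symA.
have l0 i : 0 < l 0 i.
  pose u : 'rV[R]_d := delta_mx 0 i *m U^T.
  have uU : u *m U = delta_mx 0 i by rewrite -mulmxA (mulmx1C UU) mulmx1.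
  have u0 : u != 0.
    apply/eqP => u0; move: uU; rewrite u0 mul0mx => /rowP/(_ i).
    by rewrite !mxE !eqxx => /eqP; rewrite eq_sym oner_eq0.
  have := posA _ u0; rewrite AE diag_quad uU (bigD1 i)//= big1 => [|j ji].
    by rewrite !mxE !eqxx addr0 expr1n mulr1.
  by rewrite !mxE eqxx (negPf ji) expr0n mulr0.
exists U, (map_mx (@ln R) l); split => //.
rewrite AE /expmx; congr (_ *m diag_mx _ *m _).
by apply/rowP => i; rewrite !mxE lnK ?posrE.
Qed.

(** The functional calculus does not depend on the diagonalization: if
    [U diag(l) U^T = V diag(m) V^T], then [W = V^T U] satisfies
    [W_ij l_j = m_i W_ij], so [l_j = m_i] wherever [W_ij] is nonzero, and
    therefore [W_ij f(l_j) = f(m_i) W_ij]. *)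
Lemma mxfun_diag (f : R -> R) U l : U *m U^T = 1%:M ->
  mxfun f (U *m diag_mx l *m U^T) = U *m diag_mx (map_mx f l) *m U^T.
Proof.
move=> UU; rewrite /mxfun; set P := (X in xget _ X).
have : P (U *m diag_mx (map_mx f l) *m U^T) by exists U, l.
move=> /(@xgetI _ (0 : 'M[R]_d)) [V [m [VV E ->]]].
pose W := V^T *m U.
have UtU := mulmx1C UU; have VtV := mulmx1C VV.
have WE : W *m diag_mx l = diag_mx m *m W.
  have := congr1 (fun X => V^T *m X *m U) E; rewrite !mulmxA VtV mul1mx.
  by rewrite -!mulmxA UtU mulmx1 mulmxA.
have WfE : W *m diag_mx (map_mx f l) = diag_mx (map_mx f m) *m W.
  apply/matrixP => i j; move/matrixP/(_ i j): WE.
  rewrite !mul_mx_diag !mul_diag_mx ![in X in X -> _]mxE ![in X in _ -> X]mxE mulrC => /eqP.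
  rewrite -subr_eq0 -mulrBl mulf_eq0 subr_eq0 => /orP[/eqP->|/eqP->].
    by rewrite mulrC.
  by rewrite mul0r mulr0.
have UE : U = V *m W by rewrite /W mulmxA VV mul1mx.
have WW : W *m W^T = 1%:M.
  by rewrite /W trmx_mul trmxK -!mulmxA (mulmxA U) UU mul1mx VtV.
move: W UE WW WE WfE => W -> WW _ WfE.
by rewrite -(mulmxA V W) WfE trmx_mul !mulmxA -(mulmxA _ W) WW mulmx1.
Qed.

Lemma mxpow_expmx U x t : U *m U^T = 1%:M ->
  mxpow (expmx U x) t = expmx U (t *: x).
Proof.
move=> UU; rewrite /mxpow /expmx mxfun_diag//; congr (_ *m diag_mx _ *m _).
by apply/rowP => i; rewrite !mxE /powR gt_eqF ?expR_gt0// expRK.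
Qed.

Lemma mxlog_expmx U x : U *m U^T = 1%:M ->
  mxlog (expmx U x) = U *m diag_mx x *m U^T.
Proof.
move=> UU; rewrite /mxlog /expmx mxfun_diag//; congr (_ *m diag_mx _ *m _).
by apply/rowP => i; rewrite !mxE expRK.
Qed.

Lemma frob_diag U x : U *m U^T = 1%:M ->
  frob (U *m diag_mx x *m U^T) = frob x.
Proof.
move=> UU.
have frobE m n (A : 'M[R]_(m, n)) : frob A = Num.sqrt (\tr (A *m A^T)).
  congr Num.sqrt; apply: eq_bigr => i _; rewrite mxE.
  by apply: eq_bigr => j _; rewrite mxE expr2.
rewrite !frobE; congr Num.sqrt; rewrite !trmx_mul trmxK tr_diag_mx !mulmxA.
rewrite -(mulmxA _ U^T) (mulmx1C UU) mulmx1 mxtrace_mulC.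
rewrite !mulmxA (mulmx1C UU) mul1mx mulmx_diag mxtrace_diag.
rewrite [RHS]big_ord1 mxE; apply: eq_bigr => i _.
by rewrite !mxE.
Qed.

(** Unlike [eigvals], which picks one ordering of the eigenvalues, this relation
    holds for every ordering of the logarithms of the eigenvalues. *)
Definition log_spectrum x A : Prop :=
  exists2 U : 'M[R]_d, U *m U^T = 1%:M & A = expmx U x.

Lemma spd_log_spectrum A : spd A -> exists x, log_spectrum x A.
Proof. by move=> /spd_expmx[U [x [UU AE]]]; exists x, U. Qed.

Lemma frob_mxlog A x : log_spectrum x A -> frob (mxlog A) = frob x.
Proof. by move=> [U UU ->]; rewrite mxlog_expmx// frob_diag. Qed.

Lemma char_poly_diag U l : U *m U^T = 1%:M ->
  char_poly (U *m diag_mx l *m U^T) = \prod_(i < d) ('X - (l 0 i)%:P).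
Proof.
move=> UU; rewrite /char_poly /char_poly_mx.
pose f : 'M[R]_d -> 'M[{poly R}]_d := map_mx polyC.
have fM : f U *m f U^T = 1%:M by rewrite -map_mxM UU map_mx1.
rewrite -/(f _) {1}/f !map_mxM -/(f _) -/(f U^T).
have -> : 'X%:M = f U *m 'X%:M *m f U^T.
  by rewrite mul_mx_scalar -scalemxAl fM scalemx1.
rewrite -mulmxBl -mulmxBr !det_mulmx mulrAC -det_mulmx fM det1 mul1r.
rewrite map_diag_mx -diag_const_mx -raddfB det_diag.
by apply: eq_bigr => i _; rewrite !mxE.
Qed.

(** A split polynomial determines its roots up to order. *)
Lemma eigvals_diag U l : U *m U^T = 1%:M ->
  exists s : 'S_d, eigvals (U *m diag_mx l *m U^T) = col_perm s l.
Proof.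
move=> UU; rewrite /eigvals; set P := (X in xget _ X).
have : P l by rewrite /P /= char_poly_diag.
move=> /(@xgetI _ (0 : 'rV[R]_d)); set m := xget _ _; rewrite /P /=.
rewrite char_poly_diag// => E.
have : perm_eq [tuple m 0 i | i < d] [tuple l 0 i | i < d].
  by apply: prod_XsubC_eq; rewrite !big_map -!enumT !big_enum.
move=> /tuple_permP[s sE]; exists s; apply/rowP => i.
have /(congr1 (fun t => tnth t i)) : [tuple m 0 i | i < d] =
    [tuple tnth [tuple l 0 i | i < d] (s i) | i < d] by apply: val_inj.
by rewrite !tnth_mktuple mxE.
Qed.

Lemma log_eigvals A x : log_spectrum x A ->
  exists s : 'S_d, map_mx (@ln R) (eigvals A) = col_perm s x.
Proof.
move=> [U UU ->]; have [s sE] := eigvals_diag (map_mx expR x) UU.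
by exists s; rewrite sE; apply/rowP => i; rewrite !mxE expRK.
Qed.

Definition nonincr x := forall i j : 'I_d, (i <= j)%N -> x 0 j <= x 0 i.

Lemma sort_row x : exists s : 'S_d, nonincr (col_perm s x).
Proof.
pose t := sort_tuple (fun a b => b <= a) [tuple x 0 i | i < d].
have /tuple_permP[s sE] : perm_eq t [tuple x 0 i | i < d] by rewrite perm_sort.
have tE i : tnth t i = x 0 (s i).
  have /(congr1 (fun t => tnth t i)) : t =
    [tuple tnth [tuple x 0 i | i < d] (s i) | i < d] by apply: val_inj.
  by rewrite !tnth_mktuple.
exists s => i j ij; rewrite !mxE -!tE !(tnth_nth 0).
have tr : transitive (fun a b : R => b <= a) by move=> a b c ba ac; exact: le_trans ba.
have st : sorted (fun a b : R => b <= a) t.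
  by apply: sort_sorted => a b; exact: le_total.
have szt (k : 'I_d) : (k : nat) \in [pred n | (n < size t)%N].
  by rewrite inE size_tuple ltn_ord.
have refl : reflexive (fun a b : R => b <= a) by move=> a; exact: lexx.
exact: (sorted_leq_nth tr refl 0 st _ _ (szt i) (szt j) ij).
Qed.

Lemma log_spectrum_perm A x (s : 'S_d) :
  log_spectrum x A -> log_spectrum (col_perm s x) A.
Proof.
move=> [U UU ->]; exists (col_perm s U).
  rewrite -[X in _ = X]UU; apply/matrixP => i j; rewrite !mxE.
  by rewrite [RHS](reindex_inj (@perm_inj _ s)); apply: eq_bigr => k _; rewrite !mxE.
apply/matrixP => i j; rewrite /expmx !mul_mx_diag !mxE.
by rewrite [LHS](reindex_inj (@perm_inj _ s)); apply: eq_bigr => k _; rewrite !mxE.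
Qed.

Lemma spd_sorted_log_spectrum A : spd A -> exists2 x, nonincr x & log_spectrum x A.
Proof.
move=> /spd_log_spectrum[x Ax]; have [s sx] := sort_row x.
by exists (col_perm s x) => //; apply: log_spectrum_perm.
Qed.

Lemma spd_congr A S : S \in unitmx -> spd A -> spd (S *m A *m S^T).
Proof.
move=> uS [symA posA]; split=> [|u u0].
  by rewrite !trmx_mul trmxK symA mulmxA.
have uS0 : u *m S != 0.
  by apply: contra u0 => /eqP uS0; rewrite -(mulmxK uS u) uS0 mul0mx.
by have := posA _ uS0; rewrite trmx_mul !mulmxA.
Qed.

Lemma expmx_unit U x : U *m U^T = 1%:M -> expmx U x \in unitmx.
Proof. by move=> UU; have [] := mulmx1_unit (expmxVr x UU). Qed.

Lemma spd_unit A : spd A -> A \in unitmx.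
Proof. by move=> /spd_expmx[U [x [UU ->]]]; exact: expmx_unit. Qed.

End ExpCalculus.

(** * Weyl monotonicity and the multiplicative Lidskii inequality *)
Section Lidskii.
Variables (R : realType) (d : nat).
Implicit Types (A B S U V X Y : 'M[R]_d) (x y z : 'rV[R]_d).

(** Otherwise [y_i < x_i] for some [i].  The span of the first [i + 1]
    eigenvectors of [A] and that of the eigenvectors of [B] from index [i] on
    have dimensions adding up to [d + 1], so they share a nonzero vector [u];
    but then [u B u^T <= e^(y_i) |u|^2 < e^(x_i) |u|^2 <= u A u^T]. *)
Lemma weyl_monotonicity A B x y : nonincr x -> nonincr y ->
  log_spectrum x A -> log_spectrum y B ->
  (forall u : 'rV[R]_d, (u *m A *m u^T) 0 0 <= (u *m B *m u^T) 0 0) ->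
  forall i, x 0 i <= y 0 i.
Proof.
move=> xs ys [U UU ->] [V VV ->] leAB i; rewrite leNgt; apply/negP => yx.
(* [w M = 0] collects the linear equations on the coordinates [w] of [u] in the
   eigenbasis of [A]; column [i] of [M] is zero, so a solution exists. *)
pose M : 'M[R]_d := \matrix_(k, j)
  if (j < i)%N then (U^T *m V) k j else if j == i then 0 else (k == j)%:R.
have /det0P[w w0 wM] : \det M == 0.
  rewrite (expand_det_col _ i) big1// => k _.
  by rewrite mxE ltnn eqxx mul0r.
have w_gt (j : 'I_d) : (i < j)%N -> w 0 j = 0.
  move=> ij; move/rowP/(_ j): wM; rewrite !mxE (bigD1 j)//= big1 => [|k kj].
    by rewrite mxE ltnNge (ltnW ij)/= eqxx gt_eqF//= ?mulr1 ?addr0.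
  by rewrite mxE ltnNge (ltnW ij)/= (negPf kj) if_same mulr0.
have uV_lt (j : 'I_d) : (j < i)%N -> (w *m U^T *m V) 0 j = 0.
  move=> ji; have <- : (w *m M) 0 j = 0 by rewrite wM mxE.
  rewrite -mulmxA mxE [RHS]mxE; apply: eq_bigr => k _.
  by rewrite [M k j]mxE ji.
pose u := w *m U^T.
have uU : u *m U = w by rewrite -mulmxA (mulmx1C UU) mulmx1.
have u0 : u != 0 by apply: contra w0 => /eqP u0; rewrite -uU u0 mul0mx.
have := leAB u; rewrite !diag_quad leNgt => /negP; apply.
apply: (@le_lt_trans _ _ (expR (y 0 i) * (u *m u^T) 0 0)).
  rewrite (orthogonal_sqnorm _ VV) mulr_sumr; apply: ler_sum => j _.
  have [ji|ij] := ltnP j i; first by rewrite uV_lt// expr0n !mulr0.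
  by rewrite mxE ler_wpM2r ?sqr_ge0// ler_expR ys.
apply: (@lt_le_trans _ _ (expR (x 0 i) * (u *m u^T) 0 0)).
  by rewrite ltr_pM2r ?sqnorm_gt0// ltr_expR.
rewrite (orthogonal_sqnorm _ UU) mulr_sumr; apply: ler_sum => j _.
rewrite uU; have [ij|ji] := ltnP i j; first by rewrite w_gt// expr0n !mulr0.
by rewrite mxE ler_wpM2r ?sqr_ge0// ler_expR xs.
Qed.

Lemma quad_expmx_le U x y : (forall i, x 0 i <= y 0 i) ->
  forall u : 'rV[R]_d,
    (u *m expmx U x *m u^T) 0 0 <= (u *m expmx U y *m u^T) 0 0.
Proof.
move=> xy u; rewrite !diag_quad; apply: ler_sum => i _.
by rewrite !mxE ler_wpM2r ?sqr_ge0// ler_expR.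
Qed.

Lemma quad_congr_le S A B :
  (forall u : 'rV[R]_d, (u *m A *m u^T) 0 0 <= (u *m B *m u^T) 0 0) ->
  forall u : 'rV[R]_d,
    (u *m (S *m A *m S^T) *m u^T) 0 0 <= (u *m (S *m B *m S^T) *m u^T) 0 0.
Proof.
by move=> AB u; have := AB (u *m S); rewrite trmx_mul !mulmxA.
Qed.

Lemma expmx_shift U x s : expmx U (x + const_mx s) = expR s *: expmx U x.
Proof.
rewrite /expmx scalemxAl scalemxAr -linearZ /=; congr (_ *m diag_mx _ *m _).
by apply/rowP => i; rewrite !mxE expRD mulrC.
Qed.

Lemma log_spectrum_scale x A s :
  log_spectrum x A -> log_spectrum (x + const_mx s) (expR s *: A).
Proof. by move=> [U UU ->]; exists U => //; rewrite expmx_shift. Qed.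

Lemma det_log_spectrum x A : log_spectrum x A -> \det A = expR (\sum_i x 0 i).
Proof. by move=> [U UU ->]; exact: det_expmx. Qed.

Lemma nonincr_shift x s : nonincr x -> nonincr (x + const_mx s).
Proof. by move=> xs i j ij; rewrite !mxE lerD2r xs. Qed.

Lemma log_spectrum_congr_sum S U x y z : U *m U^T = 1%:M ->
  log_spectrum x (S *m expmx U z *m S^T) -> log_spectrum y (S *m S^T) ->
  \sum_i x 0 i = \sum_i y 0 i + \sum_i z 0 i.
Proof.
move=> UU /det_log_spectrum Xx /det_log_spectrum Yy; apply: expR_inj.
by rewrite expRD -Xx -Yy -(det_expmx _ UU) !det_mulmx; ring.
Qed.

(** Replace [z] by [z' = max(z, tau)].  By Weyl monotonicity the spectrum [x']
    of [S (expmx U z') S^T] dominates [x] as well as [y + tau].  Hence the sum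
    over [I] only grows when [x] is replaced by [x'] and when it is extended to
    all indices, where it is a difference of log-determinants. *)
Lemma multiplicative_lidskii S U x y z : S \in unitmx -> U *m U^T = 1%:M ->
  nonincr x -> nonincr y ->
  log_spectrum x (S *m expmx U z *m S^T) -> log_spectrum y (S *m S^T) ->
  forall (I : {set 'I_d}) (tau : R),
    \sum_(i in I) (x 0 i - y 0 i - tau) <= \sum_i Num.max (z 0 i - tau) 0.
Proof.
move=> uS UU xs ys Xx Yy I tau.
pose z' : 'rV[R]_d := \row_i Num.max (z 0 i) tau.
have [x' x's X'x'] := spd_sorted_log_spectrum (spd_congr uS (expmx_spd z' UU)).
have xx' i : x 0 i <= x' 0 i.
  apply: weyl_monotonicity xs x's Xx X'x' _ i.
  by apply/quad_congr_le/quad_expmx_le => i; rewrite mxE le_max lexx.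
have yx' i : y 0 i + tau <= x' 0 i.
  have /weyl_monotonicity := nonincr_shift tau ys.
  move=> /(_ _ _ _ x's (log_spectrum_scale tau Yy) X'x') /(_ _ i); rewrite !mxE.
  apply; rewrite scalemxAl -[S in expR tau *: S]mulmx1 scalemxAr -(expmx0 UU).
  rewrite -expmx_shift; apply/quad_congr_le/quad_expmx_le => j.
  by rewrite !mxE add0r le_max lexx orbT.
apply: (@le_trans _ _ (\sum_(i in I) (x' 0 i - y 0 i - tau))).
  by apply: ler_sum => i _; rewrite !lerD2r.
apply: (@le_trans _ _ (\sum_i (x' 0 i - y 0 i - tau))).
  rewrite [leRHS](bigID (mem I))/= lerDl; apply: sumr_ge0 => i _.
  by rewrite subr_ge0 lerBrDl.
have -> : \sum_i Num.max (z 0 i - tau) 0 = \sum_i (z' 0 i - tau).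
  by apply: eq_bigr => i _; rewrite mxE -(subrr tau) addr_maxl.
have := log_spectrum_congr_sum UU X'x' Yy.
by rewrite !sumrB => ->; lra.
Qed.

End Lidskii.

(** * Majorization and convexity *)
Section Majorization.
Variables (R : realType) (n : nat).
Implicit Types (x y z : 'rV[R]_n) (phi : 'rV[R]_n -> R).

Lemma convex_functionE phi : convex_function setT phi ->
  forall (t : R) x y, 0 <= t -> t <= 1 ->
  phi ((1 - t) *: x + t *: y) <= (1 - t) * phi x + t * phi y.
Proof.
move=> cphi t x y t0 t1.
have := cphi (Itv01 t0 t1) y x (mem_setT _) (mem_setT _).
by rewrite /conv /= addrC [X in _ <= X -> _]addrC.
Qed.

Lemma sum_delta (P : pred 'I_n) j : \sum_(i | P i) (i == j)%:R = (P j)%:R :> R.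
Proof.
rewrite big_mkcond (bigD1 j)//= eqxx big1 ?addr0 => [|i ij]; first by case: (P j).
by rewrite (negPf ij) if_same.
Qed.

(** Hardy, Littlewood and Polya, by induction on the number of indices where [x]
    and [y] differ.  Let [k] be the first index with [y_k < x_k]; some earlier
    [j] has [x_j < y_j].  Moving the mass [del] from [y_j] to [y_k] is a convex
    combination of [y] with its transposition by [(j k)], so it does not increase
    [phi]; it keeps the prefix inequalities and makes one more coordinate of [y]
    agree with [x]. *)
Theorem convex_symmetric_majorization phi x y :
  convex_function setT phi -> perm_invariant phi -> nonincr x ->
  (forall k, \sum_(i < n | (i < k)%N) x 0 i <= \sum_(i < n | (i < k)%N) y 0 i) ->
  \sum_i x 0 i = \sum_i y 0 i -> phi x <= phi y.
Proof.
move=> cphi sphi xs; have [m] := ubnP #|[pred i | x 0 i != y 0 i]|.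
elim: m y => // m IHm y; rewrite ltnS => ym pre tot.
have [->//|xy] := eqVneq x y.
have [k0 yxk0] : exists k0, y 0 k0 < x 0 k0.
  apply: contra_notP (negP xy) => /forallNP yx; apply/eqP/rowP => i.
  have /eqP : \sum_i (y 0 i - x 0 i) = 0 by rewrite sumrB tot subrr.
  rewrite psumr_eq0 => [/allP/(_ i (mem_index_enum _))|j _].
    by rewrite subr_eq0 => /eqP.
  by rewrite subr_ge0 leNgt; apply/negP.
case: (arg_minnP (P := fun i => y 0 i < x 0 i) (fun i : 'I_n => i : nat) yxk0).
move=> k yxk kmin.
have xy_ltk (i : 'I_n) : (i < k)%N -> x 0 i <= y 0 i.
  by move=> ik; rewrite leNgt; apply/negP => /kmin; rewrite leqNgt ik.
have [j jk xyj] : exists2 j : 'I_n, (j < k)%N & x 0 j < y 0 j.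
  apply: contrapT => noj; have := pre k.+1; rewrite leNgt => /negP; apply.
  rewrite (bigD1 k)//= [ltRHS](bigD1 k)//=; apply: ltr_leD => //.
  apply: ler_sum => i; rewrite ltnS leq_eqVlt => /andP[/predU1P[/val_inj->|ik _]].
    by rewrite eqxx.
  by rewrite leNgt; apply/negP => xyi; apply: noj; exists i.
have xjk : x 0 k <= x 0 j by apply/xs/ltnW.
have kj : (k == j) = false by apply/negbTE; rewrite neq_ltn jk orbT.
pose del := Num.min (y 0 j - x 0 j) (x 0 k - y 0 k).
have del0 : 0 < del by rewrite lt_min !subr_gt0 xyj.
have delj : del <= y 0 j - x 0 j by rewrite ge_min lexx.
have delk : del <= x 0 k - y 0 k by rewrite ge_min lexx orbT.
pose y' : 'rV[R]_n := \row_i (y 0 i - del * (i == j)%:R + del * (i == k)%:R).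
have y'sum (P : pred 'I_n) : \sum_(i | P i) y' 0 i =
    \sum_(i | P i) y 0 i - del * (P j)%:R + del * (P k)%:R.
  under eq_bigr do rewrite mxE.
  by rewrite big_split sumrB /= -!mulr_sumr !sum_delta.
have y'y : phi y' <= phi y.
  (* [x_k <= x_j] makes the gap [y_j - y_k] at least [2 del], whence [s <= 1]. *)
  pose s := del / (y 0 j - y 0 k).
  have yjk : 0 < y 0 j - y 0 k by lra.
  have sE : s * (y 0 j - y 0 k) = del by rewrite divfK ?gt_eqF.
  have s0 : 0 <= s by rewrite divr_ge0// ltW.
  have s1 : s <= 1 by rewrite ler_pdivrMr//; lra.
  have -> : y' = (1 - s) *: y + s *: col_perm (tperm j k) y.
    apply/rowP => i; rewrite !mxE; case: tpermP => [->|->|/eqP/negPf ij /eqP/negPf ik].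
    - by rewrite eqxx eq_sym kj -sE ?mulr1n ?mulr0n; ring.
    - by rewrite kj eqxx -sE ?mulr1n ?mulr0n; ring.
    - by rewrite ij ik ?mulr0n; ring.
  apply: (le_trans (convex_functionE cphi _ _ s0 s1)).
  by rewrite sphi -mulrDl subrK mul1r.
apply: le_trans y'y; apply: IHm.
- apply: leq_trans ym; apply: proper_card; apply/properP; split.
    apply/fintype.subsetP => i; rewrite !inE mxE.
    have [->|ij] := eqVneq i j; first by rewrite (lt_eqF xyj).
    have [->|ik] := eqVneq i k; first by rewrite (gt_eqF yxk).
    by rewrite ?mulr0n !mulr0 subr0 addr0.
  have : del = y 0 j - x 0 j \/ del = x 0 k - y 0 k.
    by rewrite /del; case: leP; [left|right].
  case=> delE; [exists j|exists k]; rewrite !inE ?(lt_eqF xyj) ?(gt_eqF yxk)//.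
    by rewrite mxE eqxx (eq_sym j) kj mulr1 mulr0 addr0 delE subKr eqxx.
  by rewrite mxE eqxx kj mulr1 mulr0 subr0 delE addrC subrK eqxx.
- move=> m'; rewrite y'sum.
  have [km|mk] := ltnP k m'; first by rewrite (ltn_trans jk km) subrK.
  rewrite mulr0 addr0; have [jm|mj] := ltnP j m'; last by rewrite mulr0 subr0.
  rewrite mulr1 lerBrDr -lerBrDl -sumrB (bigD1 j)//=.
  apply: (le_trans delj); rewrite lerDl; apply: sumr_ge0 => i /andP[im _].
  by rewrite subr_ge0 xy_ltk// (leq_trans im).
- by rewrite tot y'sum subrK.
Qed.

(** With a threshold separating the entries in [P] from the others, the bound of
    the Lidskii inequality becomes a plain sum over [P]. *)
Lemma sum_threshold (P : pred 'I_n) z tau :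
  (forall i, P i -> tau <= z 0 i) -> (forall i, ~~ P i -> z 0 i <= tau) ->
  \sum_i Num.max (z 0 i - tau) 0 = \sum_(i | P i) (z 0 i - tau).
Proof.
move=> ge le; rewrite (bigID P)/= [X in _ + X]big1 ?addr0 => [|i /le zi].
  by apply: eq_bigr => i /ge zi; rewrite max_l// subr_ge0.
by rewrite max_r// subr_le0.
Qed.

Lemma convex_sqnorm : convex_function setT (fun x => \sum_i x 0 i ^+ 2).
Proof.
move=> t x y _ _; set s := t%:num.
have s0 : 0 <= s by rewrite /s ge0.
have s1 : s <= 1 by rewrite /s le1.
change (\sum_i (s *: x + (1 - s) *: y) 0 i ^+ 2 <=
  s * (\sum_i x 0 i ^+ 2) + (1 - s) * (\sum_i y 0 i ^+ 2)).
rewrite !mulr_sumr -big_split; apply: ler_sum => i _; rewrite !mxE /=.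
set a := x 0 i; set b := y 0 i; rewrite -subr_ge0.
have -> : s * a ^+ 2 + (1 - s) * b ^+ 2 - (s * a + (1 - s) * b) ^+ 2
  = s * (1 - s) * (a - b) ^+ 2 by ring.
by rewrite mulr_ge0 ?sqr_ge0// mulr_ge0// subr_ge0.
Qed.

Lemma perm_invariant_sqnorm : perm_invariant (fun x => \sum_i x 0 i ^+ 2).
Proof.
move=> s x; rewrite [RHS](reindex_inj (@perm_inj _ s)).
by apply: eq_bigr => i _; rewrite mxE.
Qed.

Lemma frob_row x : frob x = Num.sqrt (\sum_i x 0 i ^+ 2).
Proof. by rewrite /frob big_ord1. Qed.

Lemma frob_row_ge0 x : 0 <= frob x.
Proof. exact: sqrtr_ge0. Qed.

Lemma frob_col_perm s x : frob (col_perm s x) = frob x.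
Proof. by rewrite !frob_row perm_invariant_sqnorm. Qed.

Lemma frob_rowN x : frob (- x) = frob x.
Proof. by rewrite !frob_row; under eq_bigr do rewrite mxE sqrrN. Qed.

Lemma entry_le_frob x i : `|x 0 i| <= frob x.
Proof.
rewrite frob_row -sqrtr_sqr ler_wsqrtr// (bigD1 i)//= lerDl.
by apply: sumr_ge0 => j _; exact: sqr_ge0.
Qed.

End Majorization.

(** Let [g] be [h] minus its chord.  Midpoint convexity, with one endpoint of the
    interval where [g] vanishes, gives for each [t] a point [t'] with
    [2 g(t) <= g(t')].  A positive value of [g] would double indefinitely,
    against the upper bound. *)
Lemma midpoint_convex_bounded (R : realType) (h : R -> R) (B : R) :
  (forall s t, 0 <= s <= 1 -> 0 <= t <= 1 -> 2 * h ((s + t) / 2) <= h s + h t) ->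
  (forall t, 0 <= t <= 1 -> h t <= B) ->
  forall t, 0 <= t <= 1 -> h t <= (1 - t) * h 0 + t * h 1.
Proof.
move=> mid bnd t0 t01; rewrite -subr_le0 leNgt; apply/negP.
pose g t := h t - ((1 - t) * h 0 + t * h 1); rewrite -/(g t0) => g0.
have gh0 : g 0 = 0 by rewrite /g; ring.
have gh1 : g 1 = 0 by rewrite /g; ring.
have gmid s t : 0 <= s <= 1 -> 0 <= t <= 1 -> 2 * g ((s + t) / 2) <= g s + g t.
  move=> s01 t01'; have := mid _ _ s01 t01'; rewrite /g => mst.
  rewrite mulrBr (_ : 2 * (_ + _) = (1 - s) * h 0 + s * h 1 +
    ((1 - t) * h 0 + t * h 1)); last by field.
  by lra.
pose C := `|B| + `|h 0| + `|h 1|.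
have gC t : 0 <= t <= 1 -> g t <= C.
  move=> t01'; have /andP[ta tb] := t01'; rewrite /g /C.
  have h0 : - ((1 - t) * h 0) <= `|h 0|.
    rewrite -mulrN (le_trans (ler_norm _))// normrM normrN ler_piMl//.
    by rewrite ger0_norm; lra.
  have h1 : - (t * h 1) <= `|h 1|.
    rewrite -mulrN (le_trans (ler_norm _))// normrM normrN ler_piMl//.
    by rewrite ger0_norm; lra.
  by have := le_trans (bnd _ t01') (ler_norm B); lra.
have growth k t : 0 <= t <= 1 -> 2 ^+ k * g t <= C.
  elim: k t => [|k IHk] t t01'; first by rewrite mul1r gC.
  rewrite exprSr -mulrA; have /andP[ta tb] := t01'.
  have [t2|t2] := leP t 2^-1.
    have t2' : 0 <= 2 * t <= 1 by apply/andP; split; lra.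
    apply: le_trans (IHk _ t2'); rewrite ler_wpM2l ?exprn_ge0//.
    have := gmid 0 (2 * t); rewrite lexx ler01 gh0 !add0r => /(_ isT t2').
    by rewrite mulrAC divff ?pnatr_eq0// mul1r.
  have t2' : 0 <= 2 * t - 1 <= 1 by apply/andP; split; lra.
  apply: le_trans (IHk _ t2'); rewrite ler_wpM2l ?exprn_ge0//.
  have := gmid 1 (2 * t - 1); rewrite lexx ler01 gh1 add0r => /(_ isT t2').
  by rewrite (_ : (1 + (2 * t - 1)) / 2 = t)//; field.
have Cg0 : 0 <= C / g t0.
  by rewrite divr_ge0 ?(ltW g0)// !addr_ge0.
have := growth (Num.bound (C / g t0)) t0 t01; rewrite leNgt => /negP; apply.
rewrite -ltr_pdivrMr// (lt_le_trans (archi_boundP Cg0))//.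
by rewrite -natrX ler_nat ltnW// ltn_expl.
Qed.

(** * Spectra under congruence and along geodesics *)
Section SpectralInequalities.
Variables (R : realType) (d : nat).
Implicit Types (A B C M S U V X Y : 'M[R]_d) (x y z e : 'rV[R]_d).

Lemma perm_invariant_log_eigvals (phi : 'rV[R]_d -> R) A x :
  perm_invariant phi -> log_spectrum x A ->
  phi (map_mx (@ln R) (eigvals A)) = phi x.
Proof. by move=> sphi /log_eigvals[s ->]. Qed.

(** The Lidskii inequality says that the sorted [x - y] is majorized by [z];
    apply this to the squared Euclidean norm. *)
Lemma log_spectrum_dist S U x y z : S \in unitmx -> U *m U^T = 1%:M ->
  nonincr x -> nonincr y ->
  log_spectrum x (S *m expmx U z *m S^T) -> log_spectrum y (S *m S^T) ->
  frob (x - y) <= frob z.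
Proof.
move=> uS UU xs ys Xx Yy.
have [s ws] := sort_row (x - y); have [r zs] := sort_row z.
rewrite -(frob_col_perm s) -(frob_col_perm r z) !frob_row ler_wsqrtr//.
set w := col_perm s _ in ws *; set z' := col_perm r z in zs *.
have tot : \sum_i w 0 i = \sum_i z' 0 i.
  have wE : \sum_i w 0 i = \sum_i (x - y) 0 i.
    by rewrite [RHS](reindex_inj (@perm_inj _ s)); apply: eq_bigr => i _; rewrite mxE.
  have zE : \sum_i z' 0 i = \sum_i z 0 i.
    by rewrite [RHS](reindex_inj (@perm_inj _ r)); apply: eq_bigr => i _; rewrite mxE.
  rewrite wE zE; under eq_bigr do rewrite !mxE.
  by rewrite sumrB (log_spectrum_congr_sum UU Xx Yy); ring.
apply: (convex_symmetric_majorization (phi := fun x => \sum_i x 0 i ^+ 2) _ _ ws _ tot).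
- exact: convex_sqnorm.
- exact: perm_invariant_sqnorm.
move=> k; have [dk|kd] := leqP d k.
  have allk (v : 'rV[R]_d) : \sum_(i < d | (i < k)%N) v 0 i = \sum_i v 0 i.
    by apply: eq_bigl => i; rewrite (leq_trans (ltn_ord i) dk).
  by rewrite !allk tot.
case: k kd => [|k] kd; first by rewrite !big_pred0.
(* The threshold is the smallest of the [k + 1] largest entries of [z]. *)
pose tau := z' 0 (Ordinal (ltnW kd)).
pose I := finset (fun i => ((s^-1)%g i < k.+1)%N).
have := multiplicative_lidskii uS UU xs ys Xx Yy I tau.
have -> : \sum_i Num.max (z 0 i - tau) 0 = \sum_i Num.max (z' 0 i - tau) 0.
  by rewrite [LHS](reindex_inj (@perm_inj _ r)); apply: eq_bigr => i _; rewrite mxE.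
rewrite (@sum_threshold _ _ (fun i => (i < k.+1)%N)); last 2 first.
- by move=> i ik; apply: zs.
- by move=> i; rewrite -leqNgt => ik; apply: zs; exact: ltnW.
rewrite (reindex_inj (@perm_inj _ s))/=.
rewrite (eq_bigl (fun i : 'I_d => (i < k.+1)%N)) => [|i]; last by rewrite inE permK.
rewrite !sumrB lerD2r -sumrB; congr (_ <= _).
by apply: eq_bigr => i _; rewrite !mxE.
Qed.

(** In the application [M] is the geodesic midpoint of the matrices with spectra
    [a] and [b].  The matrix [M (expmx V (- b)) M^T] is compared with [M M^T],
    whose log-spectrum is [2 x].  As [- b] is sorted increasingly, the Lidskii
    inequality is used on the indices from [k] on; the equality of the total
    sums turns it into one on the first [k] indices. *)
Lemma lidskii_midpoint M V x a b : M^T = M -> M \in unitmx -> V *m V^T = 1%:M ->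
  nonincr x -> nonincr a -> nonincr b ->
  log_spectrum x M ->
  log_spectrum a (M *m expmx V (- b) *m M^T) ->
  forall k, 2 * \sum_(i < d | (i < k)%N) x 0 i
    <= \sum_(i < d | (i < k)%N) a 0 i + \sum_(i < d | (i < k)%N) b 0 i.
Proof.
move=> symM uM VV xs as_ bs [U UU ME] Aa k.
have x2s : nonincr (x + x) by move=> i j ij; rewrite !mxE lerD ?xs.
have MMx : log_spectrum (x + x) (M *m M^T).
  by rewrite symM ME expmxD//; exists U.
have sumxx (P : pred 'I_d) : \sum_(i | P i) (x + x) 0 i = 2 * \sum_(i | P i) x 0 i.
  by rewrite mulr_sumr; apply: eq_bigr => i _; rewrite mxE; ring.
have sumN (P : pred 'I_d) : \sum_(i | P i) (- b) 0 i = - \sum_(i | P i) b 0 i.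
  by rewrite -sumrN; apply: eq_bigr => i _; rewrite mxE.
have := log_spectrum_congr_sum VV Aa MMx; rewrite sumxx sumN => tot.
have tail : \sum_(i < d | ~~ (i < k)%N) a 0 i + \sum_(i < d | ~~ (i < k)%N) b 0 i
    <= 2 * \sum_(i < d | ~~ (i < k)%N) x 0 i.
  have [dk|kd] := leqP d k.
    rewrite !big_pred0 ?addr0 ?mulr0// => i;
    by rewrite (leq_trans (ltn_ord i) dk).
  pose I := finset (fun i : 'I_d => ~~ (i < k)%N).
  pose tau := - b 0 (Ordinal kd).
  have := multiplicative_lidskii uM VV as_ x2s Aa MMx I tau.
  rewrite (@sum_threshold _ _ (fun i => ~~ (i < k)%N)); last 2 first.
  - by move=> i; rewrite -leqNgt => ki; rewrite mxE lerN2; apply: bs.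
  - by move=> i; rewrite negbK => ik; rewrite mxE lerN2; apply/bs/ltnW.
  rewrite (eq_bigl (fun i : 'I_d => ~~ (i < k)%N)) => [|i]; last by rewrite inE.
  by rewrite !sumrB lerD2r sumxx sumN; lra.
have split_sum (v : 'rV[R]_d) : \sum_i v 0 i =
  \sum_(i < d | (i < k)%N) v 0 i + \sum_(i < d | ~~ (i < k)%N) v 0 i.
  exact: bigID.
by move: tot tail; rewrite !split_sum; lra.
Qed.

Lemma invmx_uniq A B : A *m B = 1%:M -> invmx A = B.
Proof.
move=> AB; have [uA _] := mulmx1_unit AB.
by rewrite -[LHS]mulmx1 -AB mulKmx.
Qed.

(** Algebra with congruences is stated for arbitrary factors, so that it can be
    applied to exponentials without unfolding them. *)
Lemma congr_reflect C A B D : C \in unitmx ->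
  C *m A *m C^T *m (invmx C^T *m B *m invmx C) *m (C *m D *m C^T)
  = C *m (A *m B *m D) *m C^T.
Proof.
by move=> uC; rewrite !mulmxA mulmxK ?unitmx_tr// mulmxKV.
Qed.

Lemma congr_inv C A B : C \in unitmx -> A *m B = 1%:M ->
  invmx (C *m A *m C^T) = invmx C^T *m B *m invmx C.
Proof.
move=> uC AB; have uCt : C^T \in unitmx by rewrite unitmx_tr.
have NX : C *m A *m C^T *m (invmx C^T *m B *m invmx C) = 1%:M.
  by rewrite !mulmxA mulmxK// -(mulmxA C) AB mulmx1 mulmxV.
exact: invmx_uniq NX.
Qed.

Section Curve.
Variables (C U : 'M[R]_d) (e : 'rV[R]_d).
Hypotheses (uC : C \in unitmx) (UU : U *m U^T = 1%:M).

(** All affine-invariant geodesics of positive definite matrices are of this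
    form. *)
Definition spd_curve (t : R) : 'M[R]_d := C *m expmx U (t *: e) *m C^T.
Local Notation N := spd_curve.

Lemma spd_spd_curve t : spd (N t).
Proof. by apply: spd_congr => //; exact: expmx_spd. Qed.

Lemma spd_curve_reflect a b c : N a *m invmx (N b) *m N c = N (a - b + c).
Proof.
rewrite /N (congr_inv uC (expmxVr (b *: e) UU)) congr_reflect//.
by rewrite !(expmxD _ _ UU) -scaleNr -!scalerDl.
Qed.

(** Prefix sums of the sorted log-spectrum are midpoint convex by
    [lidskii_midpoint], since [N(2m - s)] is [N(m) N(s)^-1 N(m)], and bounded on
    [0, 1] by Weyl monotonicity; hence they are convex.  The total is affine,
    being a log-determinant.  So the sorted log-spectrum at [t] is majorized by
    the combination of the sorted ones at the endpoints. *)
Theorem spd_curve_convex (phi : 'rV[R]_d -> R) t x0 x1 xt :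
  convex_function setT phi -> perm_invariant phi -> 0 <= t -> t <= 1 ->
  log_spectrum x0 (N 0) -> log_spectrum x1 (N 1) -> log_spectrum xt (N t) ->
  phi xt <= (1 - t) * phi x0 + t * phi x1.
Proof.
move=> cphi sphi t0 t1 Nx0 Nx1 Nxt.
have /choice[v vP] : forall s, exists v, nonincr v /\ log_spectrum v (N s).
  by move=> s; have [v ? ?] := spd_sorted_log_spectrum (spd_spd_curve s); exists v.
have vs s : nonincr (v s) by have [] := vP s.
have Nv s : log_spectrum (v s) (N s) by have [] := vP s.
have phiv s x : log_spectrum x (N s) -> phi x = phi (v s).
  move=> Nx; apply: (etrans (esym (perm_invariant_log_eigvals sphi Nx))).
  exact: perm_invariant_log_eigvals sphi (Nv s).
have uCC : spd (C *m C^T) by rewrite -[C in C *m _]mulmx1 -(expmx0 UU); apply/spd_congr/expmx_spd.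
have [y ys CCy] := spd_sorted_log_spectrum uCC.
rewrite (phiv _ _ Nx0) (phiv _ _ Nx1) (phiv _ _ Nxt).
apply: le_trans (convex_functionE cphi _ _ t0 t1).
apply: convex_symmetric_majorization => //; last first.
  have tot s : \sum_i v s 0 i = \sum_i y 0 i + s * \sum_i e 0 i.
    rewrite (log_spectrum_congr_sum UU (Nv s) CCy) mulr_sumr; congr (_ + _).
    by apply: eq_bigr => i _; rewrite mxE.
  under [RHS]eq_bigr do rewrite !mxE.
  by rewrite big_split /= -!mulr_sumr !tot; ring.
move=> k.
have -> : \sum_(i < d | (i < k)%N) ((1 - t) *: v 0 + t *: v 1) 0 i =
    (1 - t) * (\sum_(i < d | (i < k)%N) v 0 0 i) + t * (\sum_(i < d | (i < k)%N) v 1 0 i).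
  under eq_bigr do rewrite !mxE.
  by rewrite big_split /= -!mulr_sumr.
(* [N s <= e^m C C^T] for every [s] in [0, 1]. *)
pose m := \sum_i `|e 0 i|.
apply: (@midpoint_convex_bounded _ (fun t => \sum_(i < d | (i < k)%N) v t 0 i)
  (\sum_(i < d | (i < k)%N) (y 0 i + m))); last by rewrite t0 t1.
  move=> s r _ _; have [V VV NE] := Nv s; rewrite addrC.
  have uN := spd_unit (spd_spd_curve ((r + s) / 2)).
  have symN : (N ((r + s) / 2))^T = N ((r + s) / 2).
    by have [] := spd_spd_curve ((r + s) / 2).
  rewrite (addrC (\sum_(i < d | _) _)).
  apply: (lidskii_midpoint symN uN VV (vs _) (vs _) (vs _) (Nv _) _ k).
  have -> : expmx V (- v s) = invmx (N s).
    rewrite NE -[RHS]mul1mx -(expmxVl (v s) VV) mulmxK//.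
    exact: expmx_unit.
  have reflect := spd_curve_reflect ((r + s) / 2) s ((r + s) / 2).
  rewrite (_ : (r + s) / 2 - s + _ = r) in reflect; last by field.
  by rewrite symN reflect; exact: Nv.
move=> s /andP[s0 s1]; apply: ler_sum => i _.
have := weyl_monotonicity (vs s) (nonincr_shift m ys) (Nv s) (log_spectrum_scale m CCy).
move=> /(_ _ i); rewrite !mxE; apply.
rewrite scalemxAl -[C in expR m *: C]mulmx1 scalemxAr -(expmx0 UU).
rewrite -expmx_shift; apply/quad_congr_le/quad_expmx_le => j.
rewrite !mxE add0r (le_trans (ler_norm _))// normrM (ger0_norm s0).
rewrite (@le_trans _ _ `|e 0 j|)// ?ler_piMl//.
by rewrite /m (bigD1 j)//= lerDl; apply: sumr_ge0.
Qed.

End Curve.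
End SpectralInequalities.

(** * Continuity of convex functions on R^n *)
Section ConvexContinuity.
Variable R : realType.

Lemma convex_average n (phi : 'rV[R]_n -> R) m (p : 'I_m.+1 -> 'rV[R]_n) :
  convex_function setT phi ->
  phi (m.+1%:R^-1 *: \sum_i p i) <= m.+1%:R^-1 * \sum_i phi (p i).
Proof.
move=> cphi; elim: m p => [|m IHm] p; first by rewrite !big_ord1 invr1 scale1r mul1r.
rewrite big_ord_recr [in leRHS]big_ord_recr /=.
pose t : R := m.+2%:R^-1.
have t0 : 0 <= t by rewrite invr_ge0.
have t1 : t <= 1 by rewrite invf_le1 ?ler1n.
have tE : t = (1 - t) * m.+1%:R^-1.
  have m1 : (m.+1%:R : R) != 0 by rewrite pnatr_eq0.
  have m2 : (m.+1%:R + 1 : R) != 0 by rewrite natr1 pnatr_eq0.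
  rewrite /t -[m.+2%:R]natr1; move: (m.+1%:R : R) m1 m2 => a a0 a1.
  by field; rewrite a0 a1.
have := convex_functionE cphi (m.+1%:R^-1 *: \sum_(i < m.+1) p (widen_ord (leqnSn _) i))
  (p ord_max) t0 t1.
rewrite scalerA -tE -scalerDr => /le_trans; apply.
by rewrite -/t mulrDr lerD2r [in leRHS]tE -mulrA ler_wpM2l ?subr_ge0.
Qed.

Lemma convex_coordinate n (phi : 'rV[R]_n -> R) (x : 'rV[R]_n) i s : convex_function setT phi -> `|s| <= 1 ->
  phi (x + s *: delta_mx 0 i) - phi x <=
  `|s| * (`|phi (x + delta_mx 0 i) - phi x| + `|phi (x - delta_mx 0 i) - phi x|).
Proof.
set e := delta_mx 0 i => cphi s1.
have step (v : 'rV[R]_n) (r : R) : 0 <= r -> r <= 1 ->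
    phi (x + r *: v) - phi x <= r * `|phi (x + v) - phi x|.
  move=> r0 r1; have -> : x + r *: v = (1 - r) *: x + r *: (x + v).
    by rewrite scalerDr addrA -scalerDl subrK scale1r.
  have := convex_functionE cphi x (x + v) r0 r1.
  have := ler_wpM2l r0 (ler_norm (phi (x + v) - phi x)); lra.
have [s0|s0] := leP 0 s.
  rewrite ger0_norm// in s1 *.
  by rewrite (le_trans (step _ _ s0 s1))// ler_wpM2l// lerDl.
rewrite ltr0_norm// in s1 *; rewrite -[s in s *: _]opprK scaleNr -scalerN.
by rewrite (le_trans (step _ _ _ s1)) ?oppr_ge0 ?(ltW s0)// ler_wpM2l ?oppr_ge0 ?(ltW s0)// lerDr.
Qed.

(** The point [x + h] is the average of the points [x + n h_i e_i], which gives
    an upper bound on [phi (x + h) - phi x] linear in [h] near [0].  The lower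
    bound follows because [x] is the midpoint of [x + h] and [x - h]. *)
Lemma convex_continuous n (phi : 'rV[R]_n -> R) (x : 'rV[R]_n) eps : convex_function setT phi -> 0 < eps -> exists2 del, 0 < del &
  forall y : 'rV[R]_n, (forall i, `|y 0 i - x 0 i| < del) -> `|phi y - phi x| < eps.
Proof.
move=> cphi eps0; case: n phi cphi x => [|m] f cf x.
  by exists 1 => // y _; rewrite (thinmx0 y) (thinmx0 x) subrr normr0.
pose K_ i := `|f (x + delta_mx 0 i) - f x| + `|f (x - delta_mx 0 i) - f x|.
pose K := \sum_i K_ i.
have K_ge0 i : 0 <= K_ i by rewrite addr_ge0.
have K0 : 0 <= K by apply: sumr_ge0.
pose N : R := m.+1%:R.
have N0 : 0 < N by rewrite ltr0n.
have up b (h : 'rV[R]_m.+1) : N * b <= 1 -> (forall i, `|h 0 i| <= b) -> f (x + h) - f x <= K * b.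
  move=> Nb hb.
  have -> : x + h = N^-1 *: \sum_i (x + (N * h 0 i) *: delta_mx 0 i).
    rewrite big_split /= sumr_const card_ord -scaler_nat scalerDr scalerA.
    rewrite mulVf ?gt_eqF// scale1r scaler_sumr; congr (_ + _).
    rewrite [LHS]row_sum_delta; apply: eq_bigr => i _.
    by rewrite scalerA mulrA mulVf ?gt_eqF// mul1r.
  have := convex_average (fun i => x + (N * h 0 i) *: delta_mx 0 i) cf.
  rewrite -/N -(lerD2r (- f x)) => /le_trans; apply.
  have -> : f x = N^-1 * \sum_(i < m.+1) f x.
    by rewrite sumr_const card_ord -[f x *+ _]mulr_natl mulrA mulVf ?mul1r// gt_eqF.
  rewrite -mulrBr -sumrB ler_pdivrMl//.
  have -> : N * (K * b) = \sum_i N * b * K_ i by rewrite -mulr_sumr -/K; ring.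
  apply: ler_sum => i _.
  have Nhb : `|N * h 0 i| <= N * b by rewrite normrM gtr0_norm// ler_wpM2l ?(ltW N0).
  by rewrite (le_trans (convex_coordinate _ _ cf (le_trans Nhb Nb)))// ler_wpM2r.
pose del := Num.min N^-1 (eps / (K + 1)).
have K1 : 0 < K + 1 by rewrite ltr_wpDl.
exists del => [|z zx]; first by rewrite lt_min invr_gt0 N0 divr_gt0.
have Ndel : N * del <= 1.
  by rewrite -(mulfV (lt0r_neq0 N0)) ler_wpM2l ?(ltW N0)// ge_min lexx.
have Kdel : K * del < eps.
  apply: (@le_lt_trans _ _ (K * (eps / (K + 1)))).
    by rewrite ler_wpM2l// ge_min lexx orbT.
  by rewrite mulrCA gtr_pMr// ltr_pdivrMr// mul1r ltrDl.
have zxE : x + (z - x) = z by rewrite addrC subrK.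
have up1 := up del (z - x) Ndel.
have up2 := up del (- (z - x)) Ndel.
have {}up1 : f z - f x <= K * del.
  by rewrite -{1}zxE; apply: up1 => i; rewrite !mxE ltW.
have {}up2 : f (x - (z - x)) - f x <= K * del.
  by apply: up2 => i; rewrite mxE normrN !mxE ltW.
have mid : f x <= 2^-1 * f z + 2^-1 * f (x - (z - x)).
  have := convex_functionE cf z (x - (z - x)) (t := 2^-1).
  rewrite (_ : 1 - 2^-1 = 2^-1); last by field.
  have -> : 2^-1 *: z + 2^-1 *: (x - (z - x)) = x.
    by apply/rowP => i; rewrite !mxE; field.
  by apply; lra.
by rewrite ltr_norml; apply/andP; split; lra.
Qed.
End ConvexContinuity.

(** * Square roots of positive definite matrices *)
Section SpectralFunctionals.
Variables (R : realType) (d : nat).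
Implicit Types (A C E G H K M S U V W : 'M[R]_d) (x y g h : 'rV[R]_d).

(** Pass from [x] to [y] by changing one coordinate at a time. *)
Lemma coord_nondecreasing_le n (rho : 'rV[R]_n -> R) (x y : 'rV[R]_n) :
  coord_nondecreasing rho -> (forall i, x 0 i <= y 0 i) -> rho x <= rho y.
Proof.
move=> mono xy.
pose z k : 'rV[R]_n := \row_i if (i < k)%N then y 0 i else x 0 i.
have z0 : z 0%N = x by apply/rowP => i; rewrite mxE.
have zn : z n = y by apply/rowP => i; rewrite mxE ltn_ord.
rewrite -zn; have : (n <= n)%N by [].
elim: {-2}n => [|k IHk] kn; first by rewrite z0.
apply: (le_trans (IHk (ltnW kn))); apply: (mono (Ordinal kn)) => [j jk|].
  rewrite !mxE ltnS (leq_eqVlt j) (_ : (j == k :> nat) = false)//.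
  by apply/negbTE; apply: contra jk => /eqP jk; apply/eqP/val_inj.
by rewrite !mxE ltnn ltnSn.
Qed.

(** If [M M^T = U D U^T], then [M^-1 U D^(1/2)] is orthogonal and diagonalizes
    [M^T M]. *)
Lemma log_spectrum_gram M x : M \in unitmx ->
  log_spectrum x (M *m M^T) -> log_spectrum x (M^T *m M).
Proof.
move=> uM [U UU ME]; pose r := 2^-1 *: x.
have rr : r + r = x by rewrite -scalerDl (_ : _ + _ = 1) ?scale1r//; field.
have uMt : M^T \in unitmx by rewrite unitmx_tr.
exists (invmx M *m (U *m diag_mx (map_mx expR r))).
  rewrite trmx_mul mulmxA -(mulmxA (invmx M)).
  have -> : U *m diag_mx (map_mx expR r) *m (U *m diag_mx (map_mx expR r))^T
    = M *m M^T.
    rewrite ME -rr -expmxD// /expmx trmx_mul tr_diag_mx.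
    by rewrite !mulmxA -(mulmxA _ U^T U) (mulmx1C UU) mulmx1.
  by rewrite trmx_inv mulmxA mulVmx// mul1mx mulmxV.
rewrite {1}/expmx trmx_mul trmx_inv.
have -> : invmx M *m (U *m diag_mx (map_mx expR r)) *m diag_mx (map_mx expR x) *m
  ((U *m diag_mx (map_mx expR r))^T *m invmx M^T) =
  invmx M *m (expmx U (r + x + r)) *m invmx M^T.
  rewrite -!expmxD// /expmx trmx_mul tr_diag_mx.
  have UtU := mulmx1C UU.
  by rewrite !mulmxA -!(mulmxA _ U^T U) UtU !mulmx1.
rewrite (_ : r + x + r = x + x); last by rewrite addrAC rr.
by rewrite -expmxD// -ME !mulmxA mulVmx// mul1mx mulmxK.
Qed.

Lemma spd_sqrtP G : spd G -> exists g V,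
  [/\ V *m V^T = 1%:M, G = expmx V (g + g), mxsqrt G = expmx V g
    & mxisqrt G = expmx V (- g)].
Proof.
move=> /spd_expmx[V [x [VV GE]]]; exists (2^-1 *: x), V.
have xx : 2^-1 *: x + 2^-1 *: x = x.
  by rewrite -scalerDl (_ : _ + _ = 1) ?scale1r//; field.
split => //; first by rewrite xx.
  by rewrite GE /mxsqrt mxpow_expmx.
by rewrite GE /mxisqrt mxpow_expmx// scaleNr.
Qed.

Lemma mxsqrt_calculus G : spd G ->
  [/\ (mxsqrt G)^T = mxsqrt G, (mxisqrt G)^T = mxisqrt G,
      mxsqrt G *m mxsqrt G = G, mxsqrt G *m mxisqrt G = 1%:M
    & mxisqrt G *m mxsqrt G = 1%:M].
Proof.
move=> /spd_sqrtP[g [V [VV -> -> ->]]].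
by rewrite !tr_expmx !expmxD// subrr addNr expmx0.
Qed.

Lemma spd_whiten G H : spd G -> spd H -> spd (mxisqrt G *m H *m mxisqrt G).
Proof.
move=> /mxsqrt_calculus[_ iT _ RI IR] sH.
by have [uI _] := mulmx1_unit IR; have := spd_congr uI sH; rewrite iT.
Qed.

End SpectralFunctionals.

(** * The spectral functional Omega *)
Section OmegaProperties.
Variables (R : realType) (d : nat).
Implicit Types (A B C E G H K M S U V W : 'M[R]_d) (x y g h e : 'rV[R]_d).
Implicit Types phi : 'rV[R]_d -> R.

Lemma symmetric_gram A B D : A^T = A -> B^T = B ->
  (A *m B) *m D *m (A *m B)^T = A *m (B *m D *m B) *m A.
Proof. by move=> AT BT; rewrite trmx_mul AT BT !mulmxA. Qed.

Lemma symmetric_gram1 A B : A^T = A -> B^T = B ->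
  (A *m B) *m (A *m B)^T = A *m (B *m B) *m A.
Proof. by move=> AT BT; rewrite trmx_mul AT BT !mulmxA. Qed.

Lemma unitmx_mulI A B : A \in unitmx -> B \in unitmx -> A *m B \in unitmx.
Proof. by move=> uA uB; rewrite unitmx_mul uA. Qed.

Lemma mulmx_cancel4 A B D : A *m B = 1%:M -> B *m A = 1%:M ->
  A *m (B *m D *m B) *m A = D.
Proof. by move=> AB BA; rewrite !mulmxA AB mul1mx -mulmxA BA mulmx1. Qed.

Lemma invmx_mxisqrt G : spd G -> invmx G = mxisqrt G *m mxisqrt G.
Proof.
move=> /mxsqrt_calculus[_ _ GE RI _]; apply: invmx_uniq.
move: (mxsqrt G) (mxisqrt G) GE RI => P Q <- PQ.
by rewrite mulmxA -(mulmxA P) PQ mulmx1.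
Qed.

Lemma mxsqrt_unit G : spd G -> mxsqrt G \in unitmx.
Proof. by move=> /mxsqrt_calculus[_ _ _ RI _]; have [u _] := mulmx1_unit RI. Qed.

Lemma mxisqrt_unit G : spd G -> mxisqrt G \in unitmx.
Proof. by move=> /mxsqrt_calculus[_ _ _ _ IR]; have [u _] := mulmx1_unit IR. Qed.

(** [G^(-1/2) H G^(-1/2)] and [H^(1/2) G^-1 H^(1/2)] are the two Gram matrices of
    [H^(1/2) G^(-1/2)].  The second one depends on [G] only through its inverse,
    which moves along a curve [spd_curve] when [G] follows a geodesic. *)
Lemma Omega_inverse phi H G x : perm_invariant phi -> spd H -> spd G ->
  log_spectrum x (mxsqrt H *m invmx G *m mxsqrt H) -> Omega phi H G = phi x.
Proof.
move=> sphi sH sG Nx; apply: (perm_invariant_log_eigvals sphi).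
have [HT _ HE _ _] := mxsqrt_calculus sH.
have [_ iT _ _ _] := mxsqrt_calculus sG.
have uM := unitmx_mulI (mxsqrt_unit sH) (mxisqrt_unit sG).
have Mx : log_spectrum x ((mxsqrt H *m mxisqrt G) *m (mxsqrt H *m mxisqrt G)^T).
  by move: Nx; rewrite (invmx_mxisqrt sG) => Nx; rewrite (symmetric_gram1 HT iT).
have := log_spectrum_gram uM Mx.
have -> : (mxsqrt H *m mxisqrt G)^T *m (mxsqrt H *m mxisqrt G)
    = mxisqrt G *m H *m mxisqrt G.
  move: (mxsqrt H) (mxisqrt G) HT HE iT => P Q PT <- QT.
  by rewrite trmx_mul PT QT !mulmxA.
by [].
Qed.

Lemma ai_geodesicE G0 G1 : spd G0 -> spd G1 -> exists U e,
  [/\ U *m U^T = 1%:M, mxisqrt G0 *m G1 *m mxisqrt G0 = expmx U e &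
    forall t, ai_geodesic G0 G1 t = mxsqrt G0 *m expmx U (t *: e) *m mxsqrt G0].
Proof.
move=> sG0 sG1; have [U [e [UU E]]] := spd_expmx (spd_whiten sG0 sG1).
by exists U, e; split => // t; rewrite /ai_geodesic E mxpow_expmx.
Qed.

Lemma ai_geodesic0 G0 G1 : spd G0 -> spd G1 -> ai_geodesic G0 G1 0 = G0.
Proof.
move=> sG0 sG1; have [U [e [UU _ ->]]] := ai_geodesicE sG0 sG1.
by rewrite scale0r expmx0// mulmx1; have [] := mxsqrt_calculus sG0.
Qed.

Lemma ai_geodesic1 G0 G1 : spd G0 -> spd G1 -> ai_geodesic G0 G1 1 = G1.
Proof.
move=> sG0 sG1; have [U [e [UU E ->]]] := ai_geodesicE sG0 sG1.
rewrite scale1r -E; have [_ _ _ RI IR] := mxsqrt_calculus sG0.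
exact: mulmx_cancel4 RI IR.
Qed.

Lemma inverse_geodesic_curve H G0 G1 : spd H -> spd G0 -> spd G1 ->
  exists C U e, [/\ C \in unitmx, U *m U^T = 1%:M & forall t,
    spd (ai_geodesic G0 G1 t) /\
    mxsqrt H *m invmx (ai_geodesic G0 G1 t) *m mxsqrt H = spd_curve C U e t].
Proof.
move=> sH sG0 sG1; have [U [e [UU E geoE]]] := ai_geodesicE sG0 sG1.
have [HT _ _ _ _] := mxsqrt_calculus sH.
have [GT iT _ RI _] := mxsqrt_calculus sG0.
have uG0 := mxsqrt_unit sG0.
exists (mxsqrt H *m mxisqrt G0), U, (- e); split => //.
  exact: unitmx_mulI (mxsqrt_unit sH) (mxisqrt_unit sG0).
move=> t; rewrite geoE; split.
  by have := spd_congr uG0 (expmx_spd (t *: e) UU); rewrite GT.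
have := congr_inv uG0 (expmxVr (t *: e) UU); rewrite GT (invmx_uniq RI) => ->.
by rewrite /spd_curve (symmetric_gram _ HT iT) scalerN.
Qed.

Theorem Omega_geodesic_convex phi H G0 G1 t :
  convex_function setT phi -> perm_invariant phi ->
  spd H -> spd G0 -> spd G1 -> 0 <= t -> t <= 1 ->
  Omega phi H (ai_geodesic G0 G1 t)
    <= (1 - t) * Omega phi H G0 + t * Omega phi H G1.
Proof.
move=> cphi sphi sH sG0 sG1 t0 t1.
have [C [U [e [uC UU NE]]]] := inverse_geodesic_curve sH sG0 sG1.
have spec s : exists2 x, log_spectrum x (spd_curve C U e s) &
    Omega phi H (ai_geodesic G0 G1 s) = phi x.
  have [x Nx] := spd_log_spectrum (spd_spd_curve e uC UU s).
  exists x => //; have [sG Ns] := NE s.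
  by apply: Omega_inverse => //; rewrite Ns.
have [x0 N0] := spec 0; rewrite (ai_geodesic0 sG0 sG1) => ->.
have [x1 N1] := spec 1; rewrite (ai_geodesic1 sG0 sG1) => ->.
have [xt Nt ->] := spec t.
exact: (spd_curve_convex uC UU cphi sphi t0 t1 N0 N1 Nt).
Qed.

(** The vector [y] is chosen before [G'], so that continuity of [phi] at the
    single point [y] controls [Omega] on a whole neighbourhood of [G]. *)
Lemma Omega_dist_base phi H G : perm_invariant phi -> spd H -> spd G ->
  exists2 y, Omega phi H G = phi y & forall G', spd G' ->
    exists2 x, Omega phi H G' = phi x & frob (x - y) <= ai_dist G G'.
Proof.
move=> sphi sH sG.
have [HT _ _ _ _] := mxsqrt_calculus sH.
have [GT iT _ RI IR] := mxsqrt_calculus sG.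
pose S := mxsqrt H *m mxisqrt G.
have uS : S \in unitmx := unitmx_mulI (mxsqrt_unit sH) (mxisqrt_unit sG).
have SS : S *m S^T = mxsqrt H *m invmx G *m mxsqrt H.
  by apply: (etrans (symmetric_gram1 HT iT)); rewrite (invmx_mxisqrt sG).
have sSS : spd (S *m S^T).
  by have := spd_congr uS (expmx_spd 0 (U := 1%:M) _); rewrite expmx0 ?trmx1 ?mulmx1//; apply.
have [y ys Yy] := spd_sorted_log_spectrum sSS.
exists y => [|G' sG']; first by apply: Omega_inverse => //; rewrite -SS.
have [U [e [UU E geoE]]] := ai_geodesicE sG sG'.
have sX := spd_congr uS (expmx_spd (- e) UU).
have [x xs Xx] := spd_sorted_log_spectrum sX.
exists x; last first.
  have /frob_mxlog eE : log_spectrum e (mxisqrt G *m G' *m mxisqrt G).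
    by rewrite E; exists U.
  rewrite /ai_dist eE -(frob_rowN e).
  exact: (log_spectrum_dist uS UU xs ys Xx Yy).
apply: Omega_inverse => //; rewrite -[G'](ai_geodesic1 sG sG') geoE scale1r.
have := congr_inv (mxsqrt_unit sG) (expmxVr e UU); rewrite GT (invmx_uniq RI) => ->.
by rewrite -(symmetric_gram _ HT iT).
Qed.

(** With [S = G^(-1/2) H^(1/2)], the two whitened matrices are [S S^T] and
    [S (H^(-1/2) H' H^(-1/2)) S^T]. *)
Lemma Omega_dist_target phi H H' G : perm_invariant phi ->
  spd H -> spd H' -> spd G ->
  exists x y, [/\ Omega phi H' G = phi x, Omega phi H G = phi y
    & frob (x - y) <= ai_dist H H'].
Proof.
move=> sphi sH sH' sG.
have [HT _ HE RI IR] := mxsqrt_calculus sH.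
have [_ iT _ _ _] := mxsqrt_calculus sG.
pose S := mxisqrt G *m mxsqrt H.
have uS : S \in unitmx := unitmx_mulI (mxisqrt_unit sG) (mxsqrt_unit sH).
have SS : S *m S^T = mxisqrt G *m H *m mxisqrt G.
  apply: (etrans (symmetric_gram1 iT HT)).
  by congr (_ *m _ *m _); exact: HE.
have [U [e [UU E]]] := spd_expmx (spd_whiten sH sH').
have XE : S *m expmx U e *m S^T = mxisqrt G *m H' *m mxisqrt G.
  apply: (etrans (symmetric_gram (expmx U e) iT HT)).
  by congr (_ *m _ *m _); rewrite -E; exact: mulmx_cancel4 RI IR.
have sSS : spd (S *m S^T) by rewrite SS; apply: spd_whiten.
have sX := spd_congr uS (expmx_spd e UU).
have [y ys Yy] := spd_sorted_log_spectrum sSS.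
have [x xs Xx] := spd_sorted_log_spectrum sX.
exists x, y; split.
- by apply: (perm_invariant_log_eigvals sphi); rewrite -XE.
- by apply: (perm_invariant_log_eigvals sphi); rewrite -SS.
have /frob_mxlog eE : log_spectrum e (mxisqrt H *m H' *m mxisqrt H).
  by rewrite E; exists U.
by rewrite /ai_dist eE; exact: (log_spectrum_dist uS UU xs ys Xx Yy).
Qed.

Lemma Omega_scale phi H G c : perm_invariant phi ->
  (forall x s, phi (x + const_mx s) = phi x) -> spd H -> spd G -> 0 < c ->
  Omega phi H (c *: G) = Omega phi H G.
Proof.
move=> sphi shift sH sG c0.
have [x Mx] := spd_log_spectrum (spd_whiten sG sH).
rewrite [RHS](perm_invariant_log_eigvals sphi Mx) -(shift x (- ln c)).
apply: perm_invariant_log_eigvals => //.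
suff -> : mxisqrt (c *: G) *m H *m mxisqrt (c *: G)
  = expR (- ln c) *: (mxisqrt G *m H *m mxisqrt G) by exact: log_spectrum_scale.
have -> : mxisqrt (c *: G) = expR (- (2^-1 * ln c)) *: mxisqrt G.
  have [V [g [VV ->]]] := spd_expmx sG.
  rewrite -{1}[c]lnK ?posrE// -expmx_shift /mxisqrt !mxpow_expmx// -expmx_shift.
  by congr expmx; apply/rowP => i; rewrite !mxE; ring.
rewrite -!scalemxAl -scalemxAr scalerA -expRD; congr (expR _ *: _).
by field.
Qed.

End OmegaProperties.

(** * The objective *)
Section Objective.
Variables (R : realType) (d q : nat).
Implicit Types (F : set 'M[R]_d) (H : 'I_q -> 'M[R]_d).
Implicit Types (phi : 'I_q -> 'rV[R]_d -> R) (rho : 'rV[R]_q -> R).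

(** In dimension [0] the constant can be negative; this is why
    [euclid_lipschitz_coords] treats that case apart. *)
Lemma euclid_lipschitz_ge0 n (L : R) (f : 'rV[R]_n.+1 -> R) :
  euclid_lipschitz L f -> 0 <= L.
Proof.
move=> Lf; have := le_trans (normr_ge0 _) (Lf (delta_mx 0 0) 0).
rewrite subr0 pmulr_lge0// frob_row sqrtr_gt0 (bigD1 ord0)//= mxE !eqxx.
by rewrite expr1n ltr_pwDl// sumr_ge0// => i _; exact: sqr_ge0.
Qed.

(** Stated with squares because [L] may be negative when [n = 0]. *)
Lemma euclid_lipschitz_sqr n (L : R) (f : 'rV[R]_n -> R) x y r :
  euclid_lipschitz L f -> frob (x - y) <= r -> 0 <= r ->
  (f x - f y) ^+ 2 <= L ^+ 2 * r ^+ 2.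
Proof.
move=> Lf xy r0; rewrite -exprMn -(real_normK (num_real (f x - f y))).
rewrite -(real_normK (num_real (L * r))) lerXn2r ?nnegrE//.
apply: (le_trans (Lf x y)); rewrite normrM (ger0_norm r0).
apply: (@le_trans _ _ (`|L| * frob (x - y))); last by rewrite ler_wpM2l.
by rewrite ler_wpM2r ?frob_row_ge0// ler_norm.
Qed.

(** The next three lemmas speak of arbitrary families of reals: they isolate what
    is needed from [rho] and are then applied to the values of [Omega]. *)
Lemma nondecreasing_convex_comp rho (u v w : 'I_q -> R) t :
  convex_function setT rho -> coord_nondecreasing rho -> 0 <= t -> t <= 1 ->
  (forall a, w a <= (1 - t) * u a + t * v a) ->
  rho (\row_a w a) <= (1 - t) * rho (\row_a u a) + t * rho (\row_a v a).
Proof.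
move=> crho mono t0 t1 wuv; apply: le_trans (convex_functionE crho _ _ t0 t1).
by apply: (coord_nondecreasing_le mono) => a; rewrite !mxE.
Qed.

Lemma convex_continuous_coords rho (u : 'I_q -> R) eps :
  convex_function setT rho -> 0 < eps -> exists2 del, 0 < del &
  forall v, (forall a, `|v a - u a| < del) ->
    `|rho (\row_a v a) - rho (\row_a u a)| < eps.
Proof.
move=> crho eps0; have [del del0 near] := convex_continuous (\row_a u a) crho eps0.
by exists del => // v vu; apply: near => a; rewrite !mxE.
Qed.

Lemma euclid_lipschitz_coords rho (L : R) (u v c : 'I_q -> R) :
  euclid_lipschitz L rho -> (forall a, (v a - u a) ^+ 2 <= c a) ->
  `|rho (\row_a v a) - rho (\row_a u a)| <= L * Num.sqrt (\sum_a c a).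
Proof.
move=> Lrho uvc; apply: (le_trans (Lrho _ _)).
have dfrob : frob (\row_a v a - \row_a u a) <= Num.sqrt (\sum_a c a).
  by rewrite frob_row ler_wsqrtr//; apply: ler_sum => a _; rewrite !mxE.
case: q rho Lrho u v c {uvc} dfrob => [|n] rho Lrho u v c dfrob.
  by rewrite frob_row !big_ord0 sqrtr0 !mulr0.
by rewrite ler_wpM2l// (euclid_lipschitz_ge0 Lrho).
Qed.

Lemma objective_geod_convex F H phi rho :
  F `<=` @spd R d -> admissible H phi rho ->
  geod_convex_on F (objective H phi rho).
Proof.
move=> Fspd [sH cphi sphi crho mono] G0 G1 t FG0 FG1 t0 t1.
apply: (nondecreasing_convex_comp crho mono t0 t1) => a.
exact: (Omega_geodesic_convex (cphi a) (sphi a) (sH a) (Fspd _ FG0) (Fspd _ FG1)).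
Qed.

Lemma objective_closed F H phi rho :
  F `<=` @spd R d -> admissible H phi rho ->
  ai_closed_on F (objective H phi rho).
Proof.
move=> Fspd [sH cphi sphi crho mono] G b FG bG.
have near_gt (u v : R) : `|v - u| < u - b -> b < v.
  by rewrite ltr_norml => /andP[]; lra.
have sG := Fspd _ FG.
have eps0 : 0 < objective H phi rho G - b by rewrite subr_gt0.
have [eta eta0 rho_near] :=
  convex_continuous_coords (fun a => Omega (phi a) (H a) G) crho eps0.
have /choice[r rP] : forall a, exists r, 0 < r /\ forall G', F G' ->
    ai_dist G G' < r -> `|Omega (phi a) (H a) G' - Omega (phi a) (H a) G| < eta.
  move=> a; have [y -> near] := Omega_dist_base (sphi a) (sH a) sG.
  have [del del0 phi_near] := convex_continuous y (cphi a) eta0.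
  exists del; split => // G' FG' GG'; have [x -> xy] := near _ (Fspd _ FG').
  apply: phi_near => i; apply: le_lt_trans GG'; apply: le_trans xy.
  by have := entry_le_frob (x - y) i; rewrite !mxE.
exists (\big[Num.min/1]_a r a).
  by apply: lt_bigmin => [|a _]; [exact: ltr01 | have [] := rP a].
move=> G' FG' GG'; have : `|objective H phi rho G' - objective H phi rho G| <
    objective H phi rho G - b.
  apply: rho_near => a; have [_ ra] := rP a; apply: ra => //.
  by apply: (lt_le_trans GG'); exact: bigmin_le_cond.
exact: near_gt.
Qed.

Lemma objective_scale H phi rho c G : admissible H phi rho ->
  (forall a (x : 'rV[R]_d) (s : R), phi a (x + const_mx s) = phi a x) ->
  0 < c -> spd G -> objective H phi rho (c *: G) = objective H phi rho G.
Proof.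
move=> [sH _ sphi _ _] shift c0 sG.
have OmegaE : (fun a => Omega (phi a) (H a) (c *: G)) =
    (fun a => Omega (phi a) (H a) G) by apply/funext => a; exact: Omega_scale.
exact: (congr1 (fun w => rho (\row_a w a)) OmegaE).
Qed.

Lemma objective_perturbation H H' phi rho (L : 'I_q -> R) Lrho G :
  admissible H phi rho -> (forall a, euclid_lipschitz (L a) (phi a)) ->
  euclid_lipschitz Lrho rho -> (forall a, spd (H' a)) -> spd G ->
  `|objective H' phi rho G - objective H phi rho G| <=
  Lrho * Num.sqrt (\sum_(a < q) L a ^+ 2 * ai_dist (H a) (H' a) ^+ 2).
Proof.
move=> [sH cphi sphi crho mono] Lphi rhoL sH' sG.
have dOmega a : (Omega (phi a) (H' a) G - Omega (phi a) (H a) G) ^+ 2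
    <= L a ^+ 2 * ai_dist (H a) (H' a) ^+ 2.
  have [x [y [-> -> xy]]] := Omega_dist_target (sphi a) (sH a) (sH' a) sG.
  exact: euclid_lipschitz_sqr (Lphi a) xy (sqrtr_ge0 _).
exact: euclid_lipschitz_coords.
Qed.

End Objective.

Theorem theorem3p3 (R : realType) (d q : nat) (F : set 'M[R]_d)
    (Fspd : F `<=` @spd R d) (F0 : F !=set0)
    (Fclosed : ai_closed_set F) (Fconvex : geod_convex_set F)
    (H : 'I_q -> 'M[R]_d) (phi : 'I_q -> 'rV[R]_d -> R) (rho : 'rV[R]_q -> R)
    (Hphirho : admissible H phi rho) :
  [/\ ai_closed_on F (objective H phi rho) /\
        geod_convex_on F (objective H phi rho),
      forall (T : set R) (Ht : R -> 'I_q -> 'M[R]_d)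
          (phit : R -> 'I_q -> 'rV[R]_d -> R) (rhot : R -> 'rV[R]_q -> R),
        (forall t, T t -> admissible (Ht t) (phit t) (rhot t)) ->
        (forall a, {within T, continuous (fun t => Ht t a)}) ->
        (forall a x, {within T, continuous (fun t => phit t a x)}) ->
        (forall y, {within T, continuous (fun t => rhot t y)}) ->
        forall t, T t ->
          ai_closed_on F (objective (Ht t) (phit t) (rhot t)) /\
          geod_convex_on F (objective (Ht t) (phit t) (rhot t)),
      (forall a (x : 'rV[R]_d) (s : R), phi a (x + const_mx s) = phi a x) ->
        forall (c : R) (G : 'M[R]_d), 0 < c -> spd G ->
          objective H phi rho (c *: G) = objective H phi rho G
    & forall (L : 'I_q -> R) (Lrho : R) (Hhat : 'I_q -> 'M[R]_d),
        (forall a, euclid_lipschitz (L a) (phi a)) ->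
        euclid_lipschitz Lrho rho ->
        (forall a, spd (Hhat a)) ->
        (ereal_sup [set `|objective Hhat phi rho G - objective H phi rho G|%:E
                   | G in F]
         <= (Lrho * Num.sqrt (\sum_(a < q)
                                L a ^+ 2 * ai_dist (H a) (Hhat a) ^+ 2))%:E)%E].
Proof.
split.
- by split; [exact: objective_closed | exact: objective_geod_convex].
- move=> T Ht phit rhot adm _ _ _ t /adm admt.
  by split; [exact: objective_closed | exact: objective_geod_convex].
- by move=> shift c G c0 sG; exact: objective_scale.
- move=> L Lrho Hhat Lphi rhoL sHhat; apply: ge_ereal_sup => _ [G FG <-].
  rewrite lee_fin.
  exact: (objective_perturbation Hphirho Lphi rhoL sHhat (Fspd _ FG)).
Qed.
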